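(* Let $\mathcal{X}\subset\mathbb{R}^d$ be compact and let $X$ be the Markov chain on $\mathcal{X}$ given by $X_{n+1}=f_{n+1}(X_n)$, where $f_1,f_2,\dots$ are iid copies of an almost surely locally Lipschitz random mapping $f:\mathcal{X}\to\mathcal{X}$. Let $U:\mathcal{X}\to\mathbb{R}_+$ with $\inf U>0$. Suppose $\|\mathbb{E}Df\|_\infty=\sup_{x\in\mathcal{X}}\mathbb{E}\,Df(x)$ is finite and that $$V_*(x)=\mathbb{E}_x\Big[\sum_{k=0}^\infty U(X_k)\prod_{l=1}^{k}Df_l(X_{l-1})\Big]$$ is finite and continuous on $\mathcal{X}$. Then for any $\epsilon>0$ there exists a neural network $\{V_\theta:\theta\in\Theta\}$ and a parameter $\theta_*\in\Theta$ such that $$\|KV_{\theta_*}-V_{\theta_*}+U\|_\infty<\epsilon.$$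
   Context: $\|\cdot\|$ is the Euclidean norm and $\|\cdot\|_\infty$ the sup norm of functions on $\mathcal{X}$. For a locally Lipschitz map $g$, $Dg(x)=\lim_{\delta\to0}\sup_{x',x''\in B_\delta(x)}\frac{\|g(x')-g(x'')\|}{\|x'-x''\|}$ with $B_\delta(x)$ the open Euclidean ball. The operator $K$ acts on functions $V$ on $\mathcal{X}$ by $KV(x)=\mathbb{E}[Df(x)V(f(x))]$. $\mathbb{E}_x$ denotes expectation given $X_0=x$; the empty product equals $1$. A neural network $\{V_\theta:\theta\in\Theta\}$ is a parametric family of real functions on $\mathcal{X}$ computed by a feedforward neural network architecture (e.g. a single hidden layer with sigmoid activation), with parameter space $\Theta$ a Euclidean space. *)

(* Defs.v *)
From HB Require Import structures.
From mathcomp Require Import all_boot all_order all_algebra.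
From mathcomp Require Import all_classical all_reals all_analysis.
Set Implicit Arguments. Unset Strict Implicit. Unset Printing Implicit Defensive.
Import Order.TTheory GRing.Theory Num.Theory.
Import numFieldNormedType.Exports.
Local Open Scope classical_set_scope.
Local Open Scope ring_scope.

Section Defs.
Variables (R : realType) (d : nat).
Local Notation pt := 'rV[R]_d.

Definition enorm (v : pt) : R := Num.sqrt (\sum_(i < d) v ord0 i ^+ 2).

(* Local Lipschitz constant  Dg(x) = lim_{δ->0} sup_{x',x'' ∈ B_δ(x) ∩ X, x'≠x''}
   ‖g x' - g x''‖/‖x' - x''‖ ; the sup is nonincreasing as δ decreases, so the
   limit is the infimum over δ > 0.  0 is added to the set (ratios are >= 0) so
   that the sup is 0 rather than -oo when the ball contains a single point of X. *)
Definition Dlip (X : set pt) (g : pt -> pt) (x : pt) : \bar R :=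
  ereal_inf [set ereal_sup ([set 0%E] `|`
      [set e | exists y z, [/\ X y /\ X z, enorm (y - x) < delta, enorm (z - x) < delta,
                   y != z & e = (enorm (g y - g z) / enorm (y - z))%:E]])
    | delta in [set delta : R | 0 < delta]].

Definition locally_lipschitz_on (X : set pt) (g : pt -> pt) : Prop :=
  forall x, X x -> exists delta L : R, 0 < delta /\
    forall y z, X y -> X z -> enorm (y - x) < delta -> enorm (z - x) < delta ->
      enorm (g y - g z) <= L * enorm (y - z).

Definition borel_on (X : set pt) (U : pt -> R) : Prop :=
  forall B : set R, measurable B -> <<s open >> (X `&` U @^-1` B).

(* The Markov chain X_0 = x, X_{k+1} = f_{k+1}(X_k); here F k = f_{k+1}. *)
Fixpoint chain (T : Type) (F : nat -> T -> pt -> pt) (x : pt) (k : nat) (w : T) : pt :=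
  match k with 0 => x | k'.+1 => F k' w (chain F x k' w) end.

Definition cyl (T : Type) (g : T -> pt -> pt) (m : nat) (xs : 'I_m -> pt)
  (ix : 'I_m -> 'I_d) (Bs : 'I_m -> set R) : set T :=
  [set w | forall j, Bs j (g w (xs j) ord0 (ix j))].

Definition is_cyl_of (X : set pt) (T : Type) (g : T -> pt -> pt) (A : set T) : Prop :=
  exists m (xs : 'I_m -> pt) (ix : 'I_m -> 'I_d) (Bs : 'I_m -> set R),
    [/\ forall j, X (xs j), forall j, measurable (Bs j) & A = cyl g xs ix Bs].

(* F 0, F 1, ... are iid random maps on X: identical finite-dimensional laws, and
   mutual independence of the sigma-algebras generated by the cylinder events. *)
Definition iid_maps (X : set pt) (dT : measure_display) (T : measurableType dT)
  (P : probability T R) (F : nat -> T -> pt -> pt) : Prop :=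
  (forall n m (xs : 'I_m -> pt) ix Bs, (forall j, X (xs j)) -> (forall j, measurable (Bs j)) ->
     P (cyl (F n) xs ix Bs) = P (cyl (F 0%N) xs ix Bs)) /\
  (forall (N : nat) (A : nat -> set T), (forall n, (n < N)%N -> is_cyl_of X (F n) (A n)) ->
     fine (P (\bigcap_(n in [set n | (n < N)%N]) A n)) = \prod_(n < N) fine (P (A n))).

Definition Vstar (X : set pt) (dT : measure_display) (T : measurableType dT)
  (P : probability T R) (F : nat -> T -> pt -> pt) (U : pt -> R) (x : pt) : \bar R :=
  (\int[P]_w (\sum_(0 <= k <oo) ((U (chain F x k w))%:E *
        \prod_(l < k) Dlip X (F l w) (chain F x l w))))%E.

Definition Kop (X : set pt) (dT : measure_display) (T : measurableType dT)
  (P : probability T R) (F : nat -> T -> pt -> pt) (V : pt -> R) (x : pt) : R :=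
  fine (\int[P]_w (Dlip X (F 0%N w) x * (V (F 0%N w x))%:E))%E.

Definition sigmoid (t : R) : R := (1 + expR (- t))^-1.

Definition nnet (N : nat) (a : 'I_N -> R) (W : 'I_N -> pt) (b : 'I_N -> R) (c : R)
  (x : pt) : R :=
  \sum_(j < N) a j * sigmoid (\sum_(i < d) W j ord0 i * x ord0 i + b j) + c.

Definition supnorm (X : set pt) (h : pt -> R) : \bar R :=
  ereal_sup [set (`|h x|)%:E | x in X].

End Defs.

(* Main.v *)
Require Import Defs.
From HB Require Import structures.
From mathcomp Require Import all_boot all_order all_algebra.
From mathcomp Require Import all_classical all_reals all_analysis.
From mathcomp Require Import measurable_realfun lra ring.
Set Implicit Arguments. Unset Strict Implicit. Unset Printing Implicit Defensive.
Import Order.TTheory GRing.Theory Num.Theory.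
Import numFieldNormedType.Exports.
Local Open Scope classical_set_scope.
Local Open Scope ring_scope.

(* Write [a_k x = E_x (U X_k prod_(l <= k) Df_l (X_(l-1)))]. Conditioning on the
   first [k] maps gives [a_k = K^k U], hence [V_* = sum_k K^k U] satisfies
   [K V_* - V_* + U = 0]. Since [K] has sup-norm at most [M = sup E Df], any
   network within [eta] of [V_*] on [X] has residual at most [eta (M + 1)].
   Networks approximate continuous functions because
   [e^c sigmoid (t - c) -> e^t] as [c -> +oo], so that they approximate the
   exponentials [exp (w . x)], whose span is an algebra to which the
   Stone-Weierstrass theorem applies.

   [Dlip] is an uncountable supremum and the maps are only almost surely
   Lipschitz, so that the integrands need not be measurable. They agree off a
   null set with jointly measurable functions of the state and of the map,
   built from the values of the map on a countable dense subset of [X]; random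
   maps are treated as random elements of the cylinder sigma-algebra on
   functions. *)

(** * Stone-Weierstrass *)

(** If [Q K] failed, the sets [B] with [Q (K \ B)] would form a proper filter containing [K];
    locality of [Q] at a cluster point of it in [K] is a contradiction. *)
Lemma compact_set_ind (T : topologicalType) (K : set T) (Q : set T -> Prop) :
  compact K -> Q set0 ->
  (forall A B, Q A -> Q B -> Q (A `|` B)) ->
  (forall A B, A `<=` B -> Q B -> Q A) ->
  (forall x, K x -> exists2 B, nbhs x B & Q (B `&` K)) -> Q K.
Proof.
move=> cK Q0 QU Qsub Qloc.
pose F : set_system T := [set B | Q (K `\` B)].
have FF : Filter F.
  split.
  - by rewrite /F /= setDT.
  - by move=> A B FA FB; rewrite /F /= setDIr; apply: QU.
  - by move=> A B AB; apply: Qsub; apply: setDS.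
apply: contrapT => nQK.
have PF : ProperFilter F.
  by apply: Build_ProperFilter_ex => // A FA; apply: contrapT => nA;
    apply: nQK; apply: Qsub FA => x Kx; split=> // Ax; apply: nA; exists x.
have FK : F K by rewrite /F /= setDv.
have [x [Kx clx]] := cK F PF FK.
have [B xB QB] := Qloc x Kx.
have FB : F (~` B) by rewrite /F /= setDE setCK setIC.
by have [y []] := clx _ _ FB xB.
Qed.

Section StoneWeierstrass.
Variables (R : realType) (T : topologicalType) (K : set T) (S : set (T -> R)).
Hypotheses (cK : compact K)
  (Scst : forall c, S (fun=> c))
  (SD : forall f g, S f -> S g -> S (fun x => f x + g x))
  (SM : forall f g, S f -> S g -> S (fun x => f x * g x))
  (Sc : forall f, S f -> continuous f)
  (Ssep : forall u v, u != v -> exists2 g, S g & g u != g v).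

Let SZ c f : S f -> S (fun x => c * f x).
Proof. by move=> Sf; apply: SM. Qed.

(** Polynomials in [t] increasing to [|t|] on $[-1,1]$; being polynomials, they stay in the algebra
    [S]. *)
Fixpoint abs_iter (t : R) n : R :=
  if n is m.+1 then abs_iter t m + (t * t - abs_iter t m * abs_iter t m) / 2
  else 0.

(** With $a=|t|$, the error $e=a-q$ becomes $e(1-a+e/2)\le e(1-e/2)$ because $e\le a$; this
    recursion preserves the rate $2/(n+2)$. *)
Lemma abs_iter_bound (t : R) n : `|t| <= 1 ->
  0 <= abs_iter t n <= `|t| /\ n.+2%:R * (`|t| - abs_iter t n) <= 2.
Proof.
move=> t1; elim: n => [|n [/andP[q0 qt] IH]] /=.
  rewrite lexx normr_ge0; split => //; lra.
have -> : t * t = `|t| * `|t| by rewrite -normrM ger0_norm // -expr2 sqr_ge0.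
move: (abs_iter t n) (`|t|) t1 q0 qt IH => q a a1 q0 qa.
have : (0 : R) <= n%:R by [].
rewrite -[n.+3]addn3 -[n.+2]addn2 !natrD; move: (n%:R : R) => N N0 IH.
split; first by apply/andP; split; nra.
set e := a - q in IH *.
have -> : a - (q + (a * a - q * q) / 2) = e * (1 - a + e / 2) by rewrite /e; field.
have e0 : 0 <= e by rewrite /e; lra.
have ea : e <= a by rewrite /e; lra.
have : e * (1 - a + e / 2) <= e * (1 - e / 2) by nra.
have : (N + 3%:R) * (e * (1 - e / 2)) <= 2.
  have [e2|e2] := leP ((N + 2) * e) ((N + 2) * e); nra.
nra.
Qed.

Definition uapprox (f : T -> R) := forall e, 0 < e ->
  exists2 g, S g & forall x, K x -> `|f x - g x| <= e.


Let AS f : S f -> uapprox f.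
Proof. by move=> Sf e e0; exists f => // x _; rewrite subrr normr0 ltW. Qed.

Let AD f g : uapprox f -> uapprox g -> uapprox (fun x => f x + g x).
Proof.
move=> Af Ag e e0; have e2 : 0 < e / 2 by rewrite divr_gt0.
have [f1 Sf1 fe] := Af _ e2; have [g1 Sg1 ge] := Ag _ e2.
exists (fun x => f1 x + g1 x); first exact: SD.
move=> x Kx; rewrite opprD addrACA (le_trans (ler_normD _ _))// (splitr e).
by apply: lerD; [exact: fe|exact: ge].
Qed.

Let AZ c f : uapprox f -> uapprox (fun x => c * f x).
Proof.
move=> Af e e0; have c1 : 0 < `|c| + 1 by rewrite ltr_wpDl.
have [f1 Sf1 fe] := Af _ (divr_gt0 e0 c1).
exists (fun x => c * f1 x); first exact: SZ.
move=> x Kx; rewrite -mulrBr normrM.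
have := fe x Kx; rewrite ler_pdivlMr// mulrC; apply: le_trans.
by rewrite ler_wpM2r// lerDl.
Qed.

Let Sbounded f : S f -> exists2 M, 0 < M & forall x, K x -> `|f x| <= M.
Proof.
move=> /Sc cf.
apply: (@compact_set_ind _ K
  (fun A => exists2 M, 0 < M & forall x, A x -> `|f x| <= M)) => //.
- by exists 1.
- move=> A B [M M0 HM] [N N0 HN]; exists (M + N); first exact: addr_gt0.
  move=> x [/HM|/HN] fx; apply: (le_trans fx); first by rewrite lerDl ltW.
  by rewrite lerDr ltW.
- by move=> A B AB [M M0 HM]; exists M => // x /AB; apply: HM.
- move=> x Kx; exists [set y | `|f y - f x| < 1].
    by have /cvgrPdist_lt/(_ 1 ltr01) := cf x; apply: filterS => y /=; rewrite distrC.
  exists (`|f x| + 1); first by rewrite ltr_wpDl.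
  move=> y [/= /ltW fy _]; rewrite -[f y](subrK (f x)) addrC.
  by rewrite (le_trans (ler_normD _ _))// lerD2l.
Qed.

Let Siter f n : S f -> S (fun x => abs_iter (f x) n).
Proof.
move=> Sf; elim: n => [|n IH] /=; first exact: Scst.
apply: SD => //.
rewrite (_ : (fun _ => _) = fun x =>
    2^-1 * (f x * f x + (-1) * (abs_iter (f x) n * abs_iter (f x) n))).
  by apply: SZ; apply: SD; [exact: SM|apply: SZ; exact: SM].
by apply/funext => x; rewrite mulN1r mulrC.
Qed.

Let Sabs f : S f -> uapprox (fun x => `|f x|).
Proof.
move=> Sf e e0; have [M M0 HM] := Sbounded Sf.
(* After rescaling by [M] the error is at most $2M/(n+2)$, and this [n] satisfies $2M/e<n+1$. *)
pose n := Num.truncn (2 * M / e).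
exists (fun x => M * abs_iter (M^-1 * f x) n).
  by apply/SZ/Siter/SZ.
move=> x Kx; have t1 : `|M^-1 * f x| <= 1.
  by rewrite normrM ger0_norm ?invr_ge0 ?(ltW M0)// ler_pdivrMl ?mulr1// HM.
have [/andP[q0 qt] qe] := abs_iter_bound n t1.
have -> : `|f x| = M * `|M^-1 * f x|.
  by rewrite normrM ger0_norm ?invr_ge0 ?(ltW M0)// mulVKf// gt_eqF.
rewrite -mulrBr normrM (gtr0_norm M0) ger0_norm ?subr_ge0//.
set D := _ - _ in qe *.
have D0 : 0 <= D by rewrite subr_ge0.
have : 2 * M / e < n.+1%:R by rewrite Num.Theory.truncnS_gt.
rewrite ltr_pdivrMr// => ne.
have {}ne : 2 * M < n.+2%:R * e.
  by rewrite (lt_trans ne)// ltr_pM2r// ltr_nat.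
have n0 : 0 < n.+2%:R :> R by [].
rewrite -(ler_pM2l n0) (le_trans _ (ltW ne))// mulrCA mulrC.
by rewrite ler_wpM2r// ltW.
Qed.

Let Aabs f : uapprox f -> uapprox (fun x => `|f x|).
Proof.
move=> Af e e0; have e2 : 0 < e / 2 by rewrite divr_gt0.
have [f1 Sf1 fe] := Af _ e2; have [g Sg ge] := Sabs Sf1 e2.
exists g => // x Kx; rewrite (splitr e) -(subrK `|f1 x| `|f x|) -addrA.
rewrite (le_trans (ler_normD _ _))//; apply: lerD; last exact: ge.
by rewrite (le_trans (ler_dist_dist _ _))// fe.
Qed.

(** Lattice operations may leave [S], so continuity is carried along with approximability: the
    covering arguments need neighbourhoods. *)
Let contA f := [/\ uapprox f & {within K, continuous f}].

Let contA_max f g : contA f -> contA g -> contA (fun x => Num.max (f x) (g x)).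
Proof.
move=> [Af cf] [Ag cg]; split; last first.
  move=> x; apply: (@continuous_max _ _ (f : subspace K -> R) g); first exact: cf.
  exact: cg.
rewrite (_ : (fun _ => _) = fun x => 2^-1 * ((f x + g x) + `|f x + (-1) * g x|)).
  by apply: AZ; apply: AD; [exact: AD|apply: Aabs; apply: AD => //; exact: AZ].
by apply/funext => x; rewrite maxr_absE mulN1r mulrC.
Qed.

Let contA_min f g : contA f -> contA g -> contA (fun x => Num.min (f x) (g x)).
Proof.
move=> [Af cf] [Ag cg]; split; last first.
  move=> x; apply: (@continuous_min _ _ (f : subspace K -> R) g); first exact: cf.
  exact: cg.
rewrite (_ : (fun _ => _) = fun x => 2^-1 * ((f x + g x) + (-1) * `|f x + (-1) * g x|)).
  apply: AZ; apply: AD; first exact: AD.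
  by apply: AZ; apply: Aabs; apply: AD => //; exact: AZ.
by apply/funext => x; rewrite minr_absE !mulN1r mulrC.
Qed.

(** An affine function of a separating [g] takes any two prescribed values. *)
Let interp (V : T -> R) u v : exists2 f, S f & f u = V u /\ f v = V v.
Proof.
have [->|/Ssep[g Sg guv]] := eqVneq u v; first by exists (fun=> V v).
exists (fun x => V u + ((V v - V u) / (g v - g u)) * (g x + - g u)).
  by apply: SD => //; apply: SZ; apply: SD.
have guv' : g v - g u != 0 by rewrite subr_eq0 eq_sym.
by split; [rewrite subrr mulr0 addr0|rewrite divfK// addrCA subrr addr0].
Qed.

Let nbhs_within (f : T -> R) x e : {within K, continuous f} -> K x -> 0 < e ->
  exists2 B, nbhs x B & forall y, B y -> K y -> `|f x - f y| < e.
Proof.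
move=> /subspace_continuousP cf Kx e0.
have /cvgrPdist_lt/(_ e e0) B := cf x Kx.
by exists [set y | K y -> `|f x - f y| < e].
Qed.

(** Two rounds of compactness: maxima of interpolants give functions above [V - e / 2] that touch
    [V] at a given point, then minima of these also stay below [V + e / 2]. *)
Theorem stone_weierstrass V : {within K, continuous V} -> uapprox V.
Proof.
move=> cV e e0; have e2 : 0 < e / 2 by rewrite divr_gt0.
have e4 : 0 < e / 2 / 2 by rewrite divr_gt0.
have contS f : S f -> contA f.
  by move=> Sf; split; [exact: AS|exact/continuous_subspaceT/Sc].
have lower u : K u ->
    exists2 f, contA f & f u = V u /\ forall x, K x -> V x - e / 2 < f x.
  move=> Ku.
  apply: (@compact_set_ind _ K (fun A => exists2 f, contA f &
     f u = V u /\ forall x, A x -> V x - e / 2 < f x)) => //.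
  - by exists (fun=> V u) => //; apply: contS.
  - move=> A B [f Af [fu fA]] [g Ag [gu gB]].
    exists (fun x => Num.max (f x) (g x)); first exact: contA_max.
    split; first by rewrite fu gu maxxx.
    by move=> x [/fA|/gB] h; rewrite lt_max h// orbT.
  - by move=> A B AB [f Af [fu fA]]; exists f => //; split=> // x /AB/fA.
  - move=> v Kv; have [f Sf [fu fv]] := interp V u v.
    have [B1 nB1 HB1] := nbhs_within cV Kv e4.
    have [B2 nB2 HB2] := nbhs_within (contS _ Sf).2 Kv e4.
    exists (B1 `&` B2); first exact: filterI.
    exists f; [exact: contS|split => // x [[b1 b2] Kx]].
    (* Near [v], both [V] and [f] are within [e / 4] of their common value [V v]. *)
    have := HB1 x b1 Kx; have := HB2 x b2 Kx; rewrite fv !ltr_norml; lra.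
have [f [Af _] fV] : exists2 f, contA f &
    forall x, K x -> V x - e / 2 < f x /\ f x < V x + e / 2.
  (* The second induction must start at the empty set from some function above [V - e / 2], which
     [lower] supplies at a point of [K]. *)
  have [[u0 Ku0]|K0] := pselect (exists u, K u); last first.
    by exists (fun=> 0) => [|x Kx]; [exact: contS|case: K0; exists x].
  have [f Af [_ fA]] := lower u0 Ku0.
  suff [g Ag [gl gu]] : exists2 f, contA f &
      (forall x, K x -> V x - e / 2 < f x) /\ forall x, K x -> f x < V x + e / 2.
    by exists g => // x Kx; split; [exact: gl|exact: gu].
  apply: (@compact_set_ind _ K (fun A => exists2 f, contA f &
     (forall x, K x -> V x - e / 2 < f x) /\ forall x, A x -> f x < V x + e / 2)) => //.
  - by exists f.
  - move=> A B [g Ag [gu gA]] [h Ah [hu hB]].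
    exists (fun x => Num.min (g x) (h x)); first exact: contA_min.
    split; first by move=> x Kx; rewrite lt_min gu ?hu.
    by move=> x [/gA|/hB] H; rewrite gt_min H// orbT.
  - by move=> A B AB [g Ag [gu gA]]; exists g => //; split=> // x /AB/gA.
  - move=> v Kv; have [g Ag [gv gl]] := lower v Kv.
    have [B1 nB1 HB1] := nbhs_within cV Kv e4.
    have [B2 nB2 HB2] := nbhs_within Ag.2 Kv e4.
    exists (B1 `&` B2); first exact: filterI.
    exists g => //; split => // x [[b1 b2] Kx].
    have := HB1 x b1 Kx; have := HB2 x b2 Kx; rewrite gv !ltr_norml; lra.
have [g Sg fg] := Af _ e2.
exists g => // x Kx; have := fg x Kx; have [] := fV x Kx.
rewrite ler_norml => ? ? /andP[? ?]; rewrite ler_norml; apply/andP; split; lra.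
Qed.

End StoneWeierstrass.

(** * Density of sigmoid networks *)

Section Networks.
Variables (R : realType) (d : nat).
Local Notation pt := 'rV[R]_d.

Definition dotp (w x : pt) : R := \sum_(i < d) w ord0 i * x ord0 i.

Lemma dotpDl u v x : dotp (u + v) x = dotp u x + dotp v x.
Proof. by rewrite -big_split; apply: eq_bigr => i _; rewrite mxE mulrDl. Qed.

Lemma dotpBl u v x : dotp (u - v) x = dotp u x - dotp v x.
Proof. by rewrite -sumrB; apply: eq_bigr => i _; rewrite !mxE mulrBl. Qed.

Lemma dotpC u x : dotp u x = dotp x u.
Proof. by apply: eq_bigr => i _; rewrite mulrC. Qed.

Lemma dotp_eq0 u : dotp u u = 0 -> u = 0.
Proof.
move=> /eqP; rewrite psumr_eq0 => [/allP h|i _]; last by rewrite -expr2 sqr_ge0.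
apply/rowP => i; rewrite mxE; have := h i (mem_index_enum i).
by rewrite mulf_eq0 orbb => /eqP.
Qed.

Lemma dotp_continuous w : continuous (dotp w).
Proof.
apply: continuous_big => [|i _ x]; first exact: add_continuous.
by apply: (@cvgMl_tmp _ _ (nbhs x)); exact: coord_continuous.
Qed.

Definition expsum (s : seq (R * pt)) (x : pt) : R :=
  \sum_(p <- s) p.1 * expR (dotp p.2 x).

Lemma expsumM s t x : expsum s x * expsum t x =
  expsum [seq (p.1 * q.1, p.2 + q.2) | p <- s, q <- t] x.
Proof.
rewrite /expsum big_allpairs_dep mulr_suml; apply: eq_bigr => p _.
rewrite mulr_sumr; apply: eq_bigr => q _ /=.
by rewrite dotpDl expRD mulrACA.
Qed.

Lemma expsum_continuous s : continuous (expsum s).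
Proof.
apply: continuous_big => [|p _ x]; first exact: add_continuous.
apply: (@cvgMl_tmp _ _ (nbhs x)).
by apply: continuous_comp; [exact: dotp_continuous|exact: continuous_expR].
Qed.

(** Hidden units as a list of (output weight, input weights, bias), which grows one unit at a time
    more easily than the ordinal-indexed families of [nnet]. *)
Definition netsum (s : seq (R * pt * R)) (x : pt) : R :=
  \sum_(p <- s) p.1.1 * sigmoid (dotp p.1.2 x + p.2).

Lemma netsum_nnet s : exists N (a : 'I_N -> R) W b, netsum s = nnet a W b 0.
Proof.
pose z : R * pt * R := (0, 0, 0).
exists (size s), (fun j => (nth z s j).1.1), (fun j => (nth z s j).1.2).
exists (fun j => (nth z s j).2).
by apply/funext => x; rewrite /netsum /nnet addr0 (big_nth z) big_mkord.
Qed.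

(** The difference is exactly $e^{2t}/(e^t+e^c)$. *)
Lemma sigmoid_expR (t c : R) :
  `|expR t - expR c * sigmoid (t - c)| <= expR (2 * t - c).
Proof.
rewrite /sigmoid opprB expRB.
have -> : expR (2 * t - c) = expR t * expR t / expR c.
  by rewrite expRB -expRD; congr (expR _ / _); ring.
have := expR_gt0 t; have := expR_gt0 c.
move: (expR t) (expR c) => a b b0 a0.
have ab : 0 < a + b by rewrite addr_gt0.
have -> : a - b * (1 + b / a)^-1 = (a * a) / (a + b).
  by field; rewrite !gt_eqF.
rewrite gtr0_norm ?divr_gt0 ?mulr_gt0//.
by rewrite ler_pM2l ?mulr_gt0// lef_pV2// lerDr ltW.
Qed.

(** One unit per exponential: $a e^{w\cdot x}$ is replaced by output weight $a e^c$ and bias $-c$,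
    with error at most $|a|e^{2B-c}$ where $B$ bounds $w\cdot x$ on [X]. *)
Lemma expsum_netsum (X : set pt) s e : compact X -> 0 < e ->
  exists t, forall x, X x -> `|expsum s x - netsum t x| <= e.
Proof.
move=> cX; elim: s e => [|[a w] s IH] e e0.
  by exists [::] => x _; rewrite /expsum /netsum !big_nil subrr normr0 ltW.
have e2 : 0 < e / 2 by rewrite divr_gt0.
have [t ht] := IH _ e2.
have [B HB] : exists B, forall x, X x -> dotp w x <= B.
  have wX := continuous_compact (continuous_subspaceT (@dotp_continuous w)) cX.
  have := compact_bounded wX.
  move=> [M [Mr HM]]; exists (M + 1) => x Xx; apply: (le_trans (ler_norm _)).
  by apply: (HM (M + 1)); [rewrite ltrDl|exists x].
(* Since $e^c\ge 1+c$, this choice makes $|a|e^{2B-c}\le e/2$. *)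
pose c := `|a| * expR (2 * B) / (e / 2).
exists ((a * expR c, w, - c) :: t) => x Xx.
rewrite /expsum /netsum !big_cons -/(expsum s x) -/(netsum t x) /=.
rewrite opprD addrACA (le_trans (ler_normD _ _))// (splitr e).
apply: lerD; last exact: ht.
rewrite -mulrA -mulrBr normrM.
apply: (@le_trans _ _ (`|a| * expR (2 * B - c))).
  apply: ler_wpM2l => //; apply: (le_trans (sigmoid_expR _ _)).
  by rewrite ler_expR lerD2r ler_pM2l// HB.
rewrite expRB mulrA ler_pdivrMr ?expR_gt0// -ler_pdivrMl// mulrC.
by apply: le_trans (expR_ge1Dx c); rewrite -/c lerDr.
Qed.

Theorem nnet_dense (X : set pt) (V : pt -> R) (e : R) : compact X ->
  {within X, continuous V} -> 0 < e ->
  exists N (a : 'I_N -> R) W b, forall x, X x -> `|V x - nnet a W b 0 x| <= e.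
Proof.
move=> cX cV e0; have e2 : 0 < e / 2 by rewrite divr_gt0.
have [|||||f [s ->] sV] := @stone_weierstrass R pt X
  [set f | exists s, f = expsum s] cX _ _ _ _ _ V cV _ e2.
- move=> c; exists [:: (c, 0)]; apply/funext => x.
  rewrite /expsum big_seq1 /= /dotp big1 ?expR0 ?mulr1// => i _.
  by rewrite mxE mul0r.
- move=> _ _ [s ->] [t ->]; exists (s ++ t); apply/funext => x.
  by rewrite /expsum big_cat.
- by move=> _ _ [s ->] [t ->]; eexists; apply/funext => x; exact: expsumM.
- by move=> _ [s ->]; exact: expsum_continuous.
(* The exponential in direction $u-v$ separates: equal values at [u] and [v] would give
   $(u-v)\cdot(u-v)=0$. *)
- move=> u v uv; exists (expsum [:: (1, u - v)]); first by eexists.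
  rewrite /expsum !big_seq1 /= !mul1r; apply: contra uv => /eqP/expR_inj/eqP.
  rewrite -subr_eq0 dotpC (dotpC _ v) -dotpBl => /eqP/dotp_eq0/eqP.
  by rewrite subr_eq0.
have [t ht] := expsum_netsum s cX e2.
have [N [a [W [b E]]]] := netsum_nnet t.
exists N, a, W, b => x Xx; rewrite -E.
rewrite (splitr e) -(subrK (expsum s x) (V x)) -addrA.
by rewrite (le_trans (ler_normD _ _))//; apply: lerD; [exact: sV|exact: ht].
Qed.
End Networks.

(** * Weighted Markov chains driven by iid random elements *)

Section IndependentIntegral.
Local Open Scope ereal_scope.
Context d1 d2 dT (T1 : measurableType d1) (T2 : measurableType d2)
  (T : measurableType dT) (R : realType) (P : probability T R).
Variables (A : {mfun T >-> T1}) (B : {mfun T >-> T2}).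

(** Agreement on rectangles makes the joint law the product of the marginal laws; Tonelli's theorem
    then iterates the integral. *)
Lemma indep_integral (g : T1 * T2 -> \bar R) :
  (forall a b, measurable a -> measurable b ->
    P (A @^-1` a `&` B @^-1` b) = P (A @^-1` a) * P (B @^-1` b)) ->
  measurable_fun [set: T1 * T2] g -> (forall z, 0 <= g z) ->
  \int[P]_w g (A w, B w) = \int[P]_w \int[P]_w' g (A w, B w').
Proof.
move=> indAB mg g0.
have mAB : measurable_fun setT (fun w => (A w, B w)).
  by apply: measurable_fun_pair.
pose AB : {mfun T >-> (T1 * T2)%type} :=
  HB.pack (fun w => (A w, B w)) (isMeasurableFun.Build _ _ _ _ _ mAB).
have -> : \int[P]_w g (A w, B w) = \int[distribution P AB]_z g z.
  by rewrite ge0_integral_distribution.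
rewrite (@eq_measure_integral _ _ _ _ (distribution P A \x distribution P B)); last first.
  move=> X mX _; apply/esym; exact: product_measure_unique.
rewrite fubini_tonelli1//.
rewrite ge0_integral_distribution//=; last 2 first.
- exact: measurable_fun_fubini_tonelli_F.
- by move=> x; apply: integral_ge0.
apply: eq_integral => w _; rewrite /fubini_F/=.
rewrite (ge0_integral_distribution B (f := fun y => g (A w, y)))//.
exact/measurableT_comp.
Qed.
End IndependentIntegral.

Section IdenticalIntegral.
Local Open Scope ereal_scope.
Context d1 dT (T1 : measurableType d1)
  (T : measurableType dT) (R : realType) (P : probability T R).

Lemma identical_integral (A B : {mfun T >-> T1}) (g : T1 -> \bar R) :
  (forall a, measurable a -> P (A @^-1` a) = P (B @^-1` a)) ->
  measurable_fun setT g -> (forall z, 0 <= g z) ->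
  \int[P]_w g (A w) = \int[P]_w g (B w).
Proof.
move=> AB mg g0.
have E X : \int[P]_w g ((X : {mfun T >-> T1}) w) = \int[distribution P X]_z g z.
  by rewrite ge0_integral_distribution.
by rewrite !E; apply: eq_measure_integral => a ma _; exact: AB.
Qed.
End IdenticalIntegral.

Section PiLambda.
Context dT (T : measurableType dT) (R : realType) (P : probability T R).

(** For fixed [C], $A\mapsto P(A\cap C)$ and $A\mapsto P(A)P(C)$ are finite measures agreeing on the
    pi-system [G], hence on the sigma-algebra it generates. *)
Lemma indep_sigma (G : set (set T)) (C : set T) : setI_closed G -> G setT ->
  G `<=` measurable -> measurable C ->
  (forall A, G A -> P (A `&` C) = P A * P C)%E ->
  forall A, <<s G >> A -> P (A `&` C) = (P A * P C)%E.
Proof.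
move=> GI GT mG mC GC A sA.
have PC0 : 0 <= fine (P C) by rewrite fine_ge0.
have PCE : P C = (fine (P C))%:E by rewrite fineK ?fin_num_measure.
have mE B : mscale (NngNum PC0) P B = (P B * P C)%E.
  by rewrite /mscale /= -[X in (X * _)%E]/((fine (P C))%:E) -PCE muleC.
rewrite -mE -[LHS]/(mrestr P mC A).
apply: (@g_sigma_algebra_measure_unique _ R T G mG (fun=> setT) (fun=> GT)) => //.
- by rewrite bigcup_const.
- by move=> B GB; transitivity (P B * P C)%E; [exact: GC|exact/esym/mE].
- by move=> _; rewrite -[X in (X < _)%E]/(P (setT `&` C)) setTI PCE ltry.
Qed.

End PiLambda.

(** The factor may be [+oo], as weights of the chain may be: then either some term is nonzero and
    both sides are [+oo], or all terms vanish. *)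
Lemma nneseriesZl_ereal (R : realType) (x : \bar R) (f : nat -> \bar R) :
  (0 <= x)%E -> (forall i, 0 <= f i)%E ->
  (\sum_(0 <= i <oo) (x * f i) = x * \sum_(0 <= i <oo) f i)%E.
Proof.
case: x => [r||//] x0 f0; first by rewrite nneseriesZl.
have [[k fk]|/forallNP f00] := pselect (exists k, f k != 0%E).
  have fk0 : (0 < f k)%E by rewrite lt0e fk f0.
  have Sf0 : (0 < \sum_(0 <= i <oo) f i)%E.
    apply: (lt_le_trans fk0).
    apply: (le_trans _ (@nneseries_lim_ge R f xpredT 0%N k.+1 _)) => //.
    by rewrite big_nat_recr//= leeDr// sume_ge0.
  rewrite (gt0_mulye Sf0) (@nneseries_pinfty _ _ xpredT k)//.
    by move=> n _; rewrite mule_ge0.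
  by rewrite gt0_mulye.
have {}f00 k : f k = 0%E by apply/eqP/negPn/negP; exact: f00.
by rewrite !eseries0 ?mule0// => k _ _; rewrite f00 mule0.
Qed.

(** * The weighted chain, its kernel and its potential *)

Section WeightedChain.
Local Open Scope ereal_scope.
Context dS dZ dT (S : measurableType dS) (Z : measurableType dZ)
  (T : measurableType dT) (R : realType) (P : probability T R).
(* [G k] generates the sigma-algebra of the past [xi 0, ..., xi (k - 1)]. *)
Variables (xi : nat -> T -> Z) (G : nat -> set (set T)).
Variables (st : S * Z -> S) (wt : S * Z -> \bar R).
Hypotheses (mxi : forall k, measurable_fun setT (xi k))
  (Gm : forall k, G k `<=` measurable)
  (Gsub : forall k, G k `<=` G k.+1)
  (Gxi : forall k B, measurable B -> <<s G k.+1 >> (xi k @^-1` B))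
  (indepG : forall k A B, <<s G k >> A -> measurable B ->
     P (A `&` xi k @^-1` B) = P A * P (xi k @^-1` B))
  (ident : forall k B, measurable B -> P (xi k @^-1` B) = P (xi 0%N @^-1` B))
  (mst : measurable_fun [set: S * Z] st) (mwt : measurable_fun [set: S * Z] wt)
  (wt0 : forall z, 0 <= wt z).

(** The sample space under the sigma-algebra of the past: being adapted is being measurable on
    [T' k]. *)
Let T' k := g_sigma_algebraType (G k).

Let xi_mfun k : {mfun T >-> Z} :=
  HB.pack (xi k) (isMeasurableFun.Build _ _ _ _ _ (mxi k)).

Fixpoint wstate (s : S) (k : nat) (w : T) : S :=
  if k is k'.+1 then st (wstate s k' w, xi k' w) else s.

Fixpoint wweight (s : S) (k : nat) (w : T) : \bar R :=
  if k is k'.+1 then wweight s k' w * wt (wstate s k' w, xi k' w) else 1.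

(** The operator $K$ of the theorem, abstractly, on functions with values in $[0,+\infty]$, where no
    integrability issue arises. *)
Definition wker (h : S -> \bar R) (s : S) : \bar R :=
  \int[P]_w (wt (s, xi 0%N w) * h (st (s, xi 0%N w))).

Lemma wweight_ge0 s k w : 0 <= wweight s k w.
Proof. by elim: k => //= k IH; rewrite mule_ge0. Qed.

Lemma wker_ge0 h s : (forall s, 0 <= h s) -> 0 <= wker h s.
Proof. by move=> h0; apply: integral_ge0 => w _; rewrite mule_ge0. Qed.

Let m_integrand (h : S -> \bar R) : measurable_fun setT h ->
  measurable_fun [set: S * Z] (fun z => wt z * h (st z)).
Proof. by move=> mh; apply: emeasurable_funM => //; exact/measurableT_comp. Qed.

Lemma measurable_wker h : measurable_fun setT h -> (forall s, 0 <= h s) ->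
  measurable_fun setT (wker h).
Proof.
move=> mh h0.
have := @measurable_fun_fubini_tonelli_F _ _ S Z R (distribution P (xi_mfun 0%N))
  (fun z => wt z * h (st z)) (m_integrand mh) (fun z => mule_ge0 (wt0 z) (h0 _)).
apply: eq_measurable_fun => s _; rewrite /fubini_F /wker.
rewrite (ge0_integral_distribution (xi_mfun 0%N)
  (f := fun y => wt (s, y) * h (st (s, y)))) //.
  exact: (measurableT_comp (m_integrand mh)).
by move=> y; rewrite mule_ge0.
Qed.

Let T'S d' (U : measurableType d') k (f : T -> U) :
  measurable_fun [set: T' k] f -> measurable_fun [set: T' k.+1] f.
Proof.
move=> mf _ B mB; have := mf measurableT _ mB.
by apply: sub_sigma_algebra2; exact: Gsub.
Qed.

Let mxi' k : measurable_fun [set: T' k.+1] (xi k).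
Proof. by move=> _ B mB; rewrite setTI; exact: Gxi. Qed.

Let mstate' s k : measurable_fun [set: T' k] (wstate s k).
Proof.
elim: k => [|k IH] /=; first exact: measurable_cst.
apply: (measurableT_comp mst); apply: measurable_fun_pair; last exact: mxi'.
exact: T'S.
Qed.

Let mweight' s k : measurable_fun [set: T' k] (wweight s k).
Proof.
elim: k => [|k IH] /=; first exact: measurable_cst.
apply: emeasurable_funM; first exact: T'S.
apply: (measurableT_comp mwt); apply: measurable_fun_pair; last exact: mxi'.
exact: T'S (@mstate' s k).
Qed.

Let fromT' d' (U : measurableType d') k (f : T -> U) :
  measurable_fun [set: T' k] f -> measurable_fun [set: T] f.
Proof.
move=> mf _ B mB; have := mf measurableT _ mB.
by apply: smallest_sub; [exact: sigma_algebra_measurable|exact: Gm].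
Qed.

Lemma measurable_wstate s k : measurable_fun setT (wstate s k).
Proof. exact: fromT' (@mstate' s k). Qed.

Lemma measurable_wweight s k : measurable_fun setT (wweight s k).
Proof. exact: fromT' (@mweight' s k). Qed.

(** The whole past as a single random element, to be paired with [xi k] in [indep_integral]. *)
Let id' k : {mfun T >-> T' k} := HB.pack (fun w : T => w : T' k)
  (isMeasurableFun.Build _ _ T (T' k) _
    (@fromT' _ (T' k) k id (@measurable_id _ (T' k) setT))).

(** Markov property: state and weight at time [k] depend on the past only, so the independent [xi k]
    is integrated first, and is replaced by [xi 0], which has the same law. *)
Lemma wchain_step s k h : measurable_fun setT h -> (forall s, 0 <= h s) ->
  \int[P]_w (wweight s k.+1 w * h (wstate s k.+1 w)) =
  \int[P]_w (wweight s k w * wker h (wstate s k w)).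
Proof.
move=> mh h0.
pose g (z : T' k * Z) := wweight s k z.1 *
  (wt (wstate s k z.1, z.2) * h (st (wstate s k z.1, z.2))).
have mg : measurable_fun [set: T' k * Z] g.
  apply: emeasurable_funM.
    exact: (measurableT_comp (@mweight' s k) measurable_fst).
  apply: (measurableT_comp (m_integrand mh)); apply: measurable_fun_pair.
    exact: (measurableT_comp (@mstate' s k) measurable_fst).
  exact: measurable_snd.
transitivity (\int[P]_w g (id' k w, xi_mfun k w)).
  by apply: eq_integral => w _; rewrite /g /= muleA.
rewrite indep_integral//; last 2 first.
- by move=> a b ma mb; exact: indepG.
- by move=> z; rewrite !mule_ge0// wweight_ge0.
apply: eq_integral => w _; rewrite /g /=.
have mws : measurable_fun setT (fun z => wt (wstate s k w, z) * h (st (wstate s k w, z))).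
  exact: (measurableT_comp (m_integrand mh)).
rewrite ge0_integralZl//; last 3 first.
- exact: (measurableT_comp mws).
- by move=> w' _; rewrite mule_ge0.
- exact: wweight_ge0.
congr (_ * _).
apply: (@identical_integral _ _ _ _ _ P (xi_mfun k) (xi_mfun 0%N)
  (fun z => wt (wstate s k w, z) * h (st (wstate s k w, z)))) => //.
- by move=> a ma; exact: ident.
- by move=> z; rewrite mule_ge0.
Qed.

Lemma wker_iter h k : measurable_fun setT h -> (forall s, 0 <= h s) ->
  measurable_fun setT (iter k wker h) /\ forall s, 0 <= iter k wker h s.
Proof.
move=> mh h0; elim: k => //= k [mk k0]; split; first exact: measurable_wker.
by move=> s; exact: wker_ge0.
Qed.

(** Removing the last step turns [h] into [wker h], so the induction is over all [h]. *)
Lemma wchain_iter s k h : measurable_fun setT h -> (forall s, 0 <= h s) ->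
  \int[P]_w (wweight s k w * h (wstate s k w)) = iter k wker h s.
Proof.
elim: k h => [|k IH] h mh h0.
  by rewrite /= mul1e integral_cst// -[X in _ * X]/(P setT) probability_setT mule1.
rewrite wchain_step// IH; last 2 first.
- exact: measurable_wker.
- by move=> ?; exact: wker_ge0.
by rewrite -iterSr.
Qed.

(** The Neumann series of the kernel applied to [h]. *)
Definition wpotential h s : \bar R := \sum_(0 <= k <oo) iter k wker h s.

Lemma measurable_wpotential h : measurable_fun setT h -> (forall s, 0 <= h s) ->
  measurable_fun setT (wpotential h).
Proof.
move=> mh h0; apply: ge0_emeasurable_sum => [k x _ _|k _].
- by have [] := wker_iter k mh h0.
- by have [] := wker_iter k mh h0.
Qed.

Lemma wpotentialE h s : measurable_fun setT h -> (forall s, 0 <= h s) ->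
  wpotential h s = \int[P]_w \sum_(0 <= k <oo) (wweight s k w * h (wstate s k w)).
Proof.
move=> mh h0; rewrite integral_nneseries//; last 2 first.
- move=> k; apply: emeasurable_funM; first exact: measurable_wweight.
  by apply: measurableT_comp => //; exact: measurable_wstate.
- by move=> k w _; rewrite mule_ge0// wweight_ge0.
by apply: eq_eseriesr => k _; rewrite wchain_iter.
Qed.

(** The term [k = 0] is [h]; the kernel commutes with the sum of the others by monotone convergence.
    The identity holds in $[0,+\infty]$. *)
Lemma wpotential_poisson h s : measurable_fun setT h -> (forall s, 0 <= h s) ->
  wpotential h s = h s + wker (wpotential h) s.
Proof.
move=> mh h0; rewrite /wpotential nneseries_recl//; last first.
  by move=> k _; have [_] := wker_iter k mh h0.
congr (_ + _); rewrite [RHS]/wker.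
have mk k := (wker_iter k mh h0).1; have k0 k := (wker_iter k mh h0).2.
under eq_integral => w _ do rewrite -nneseriesZl_ereal//.
rewrite integral_nneseries//; last 2 first.
- move=> k; apply: (measurableT_comp (m_integrand (mk k))).
  exact: measurable_fun_pair.
- by move=> k w _; rewrite mule_ge0.
by rewrite -(nneseries_addn 1%N)//; apply: eq_eseriesr => k _; rewrite addn1.
Qed.

End WeightedChain.

(** * The cylinder sigma-algebra *)

Section Cylinders.
Variables (R : realType) (d : nat) (X : set 'rV[R]_d).
Local Notation pt := 'rV[R]_d.

(** The canonical space of maps, with the sigma-algebra generated by evaluation at points of [X];
    each [F k] is a random element of it. *)
Definition mapsp := g_sigma_algebraType (is_cyl_of X (fun phi : pt -> pt => phi)).
HB.instance Definition _ := Measurable.on mapsp.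

Lemma cyl_setT (T : Type) (g : T -> pt -> pt) : is_cyl_of X g setT.
Proof.
exists 0%N, (fun=> 0), (fun j : 'I_0 => False_rect _ (notF (ltn_ord j))).
exists (fun=> setT); split.
- by case.
- by [].
- by rewrite /cyl; apply/seteqP; split=> // w _ [].
Qed.

Lemma cyl_setI (T : Type) (g : T -> pt -> pt) : setI_closed (is_cyl_of X g).
Proof.
move=> _ _ [m1 [x1 [i1 [B1 [X1 M1 ->]]]]] [m2 [x2 [i2 [B2 [X2 M2 ->]]]]].
pose glue A (a : 'I_m1 -> A) (b : 'I_m2 -> A) (j : 'I_(m1 + m2)) :=
  match fintype.split j with inl j => a j | inr j => b j end.
exists (m1 + m2)%N, (glue _ x1 x2), (glue _ i1 i2), (glue _ B1 B2).
rewrite /glue; split => [j|j|].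
- by case: fintype.split.
- by case: fintype.split.
- apply/seteqP; split=> [w [h1 h2] j|w h]; first by case: fintype.split.
  split=> j.
    by have := h (lshift m2 j); rewrite -[lshift m2 j]/(unsplit (inl j)) unsplitK.
  by have := h (rshift m1 j); rewrite -[rshift m1 j]/(unsplit (inr j)) unsplitK.
Qed.

Lemma cyl_preimage (T : Type) (g : T -> pt -> pt) A :
  is_cyl_of X (fun phi : pt -> pt => phi) A -> is_cyl_of X g (g @^-1` A).
Proof. by move=> [m [xs [ix [Bs [HX HB ->]]]]]; exists m, xs, ix, Bs. Qed.

(** * Independence and identity in law of the random maps *)

Section IID.
Context (dT : measure_display) (T : measurableType dT) (P : probability T R)
  (F : nat -> T -> pt -> pt).
Hypothesis mF : forall n x (i : 'I_d), X x ->
  measurable_fun setT (fun w => F n w x ord0 i).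
Hypothesis iidF : iid_maps X P F.

Lemma measurable_cyl n A : is_cyl_of X (F n) A -> measurable A.
Proof.
move=> [m [xs [ix [Bs [HX HB ->]]]]].
rewrite (_ : cyl _ _ _ _ = \bigcap_(j in [set: 'I_m])
    ((fun w => F n w (xs j) ord0 (ix j)) @^-1` Bs j)); last first.
  by apply/seteqP; split=> w h j; [move=> _; exact: (h j)|exact: (h j I)].
apply: fin_bigcap_measurable => [|j _]; first exact: finite_finset.
by rewrite -[X in measurable X]setTI; exact: mF.
Qed.

(** A pi-system generating the past, made of exactly the intersections whose probabilities
    [iid_maps] factors. *)
Definition past k : set (set T) := [set A | exists2 B : nat -> set T,
  (forall n, (n < k)%N -> is_cyl_of X (F n) (B n)) &
  A = \bigcap_(n in [set n | (n < k)%N]) B n].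

Lemma past_setI k : setI_closed (past k).
Proof.
move=> _ _ [A cA ->] [B cB ->]; exists (fun n => A n `&` B n).
  by move=> n nk; apply: cyl_setI; [exact: cA|exact: cB].
by rewrite bigcapI.
Qed.

Lemma past_setT k : past k setT.
Proof.
exists (fun=> setT) => [n _|]; first exact: cyl_setT.
by rewrite bigcapT.
Qed.

Lemma past_measurable k : past k `<=` measurable.
Proof.
move=> _ [B cB ->]; rewrite bigcap_mkcond; apply: bigcap_measurableType => n _.
by case: ifPn => // /set_mem/cB/measurable_cyl.
Qed.

Lemma past_extend k A B : past k A -> is_cyl_of X (F k) B -> past k.+1 (A `&` B).
Proof.
move=> [C cC ->] cB.
exists (fun n => if (n < k)%N then C n else if n == k then B else setT).
  move=> n _; case: ifPn => [/cC//|_]; case: eqVneq => [->//|_].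
  exact: cyl_setT.
apply/seteqP; split => [w [hC hB] n /= nk|w h].
  by case: ifPn => [/hC//|_]; case: eqVneq.
split; first by move=> n /= nk; have := h n (leqW nk); rewrite nk.
by have := h k (ltnSn k); rewrite ltnn eqxx.
Qed.

Lemma past_sub k : past k `<=` past k.+1.
Proof. by move=> A pA; rewrite -(setIT A); apply: past_extend pA (cyl_setT _). Qed.

Lemma cyl_past k : is_cyl_of X (F k) `<=` past k.+1.
Proof. by move=> A cA; rewrite -(setTI A); apply: past_extend cA; exact: past_setT. Qed.

Lemma preimage_sigma_cyl (g : T -> pt -> pt) (B : set mapsp) :
  measurable B -> <<s is_cyl_of X g >> (g @^-1` B).
Proof.
move=> mB.
have : measurable_fun [set: g_sigma_algebraType (is_cyl_of X g)] (g : _ -> mapsp).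
  move=> mT; apply: (@measurability _ _ (g_sigma_algebraType (is_cyl_of X g)) mapsp
    setT g (is_cyl_of X (fun phi : pt -> pt => phi))) => // _ [A cA <-].
  by rewrite setTI; apply: sub_sigma_algebra; exact: cyl_preimage.
by move=> /(_ measurableT _ mB); rewrite setTI.
Qed.

Lemma past_preimage k (B : set mapsp) : measurable B -> <<s past k.+1 >> (F k @^-1` B).
Proof.
by move=> /(preimage_sigma_cyl (g := F k)); apply: sub_sigma_algebra2; exact: cyl_past.
Qed.

Lemma measurable_map k : measurable_fun setT (F k : T -> mapsp).
Proof.
move=> _ B mB; rewrite setTI; have := @past_preimage k _ mB.
by apply: smallest_sub; [exact: sigma_algebra_measurable|exact: past_measurable].
Qed.

Let fineP_mul A B C : measurable A -> measurable B -> measurable C ->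
  fine (P A) = fine (P B) * fine (P C) -> (P A = P B * P C)%E.
Proof.
move=> mA mB mC E; rewrite -(fineK (fin_num_measure P _ mA)) E.
by rewrite EFinM !fineK ?fin_num_measure.
Qed.

(** Two uses of [indep_sigma]: one extends from cylinders of [F k] to all its events, the other from
    [past k] to the generated sigma-algebra. *)
Lemma past_indep k A (B : set mapsp) : <<s past k >> A -> measurable B ->
  (P (A `&` F k @^-1` B) = P A * P (F k @^-1` B))%E.
Proof.
move=> sA mB; have mA : measurable A.
  by apply: smallest_sub sA; [exact: sigma_algebra_measurable|exact: past_measurable].
rewrite setIC muleC.
apply: (@indep_sigma _ _ _ _ (is_cyl_of X (F k))) => //.
- exact: cyl_setI.
- exact: cyl_setT.
- exact: measurable_cyl.
- move=> C cC; rewrite setIC muleC.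
  apply: (@indep_sigma _ _ _ _ (past k)) => //.
  + exact: past_setI.
  + exact: past_setT.
  + exact: past_measurable.
  + exact: measurable_cyl cC.
  + move=> _ [D cD ->].
    (* Placing [C] at index [k] lets the product formula for [k.+1] maps be regrouped by the one for
       [k] maps. *)
    pose E n := if (n < k)%N then D n else C.
    have cE n : (n < k.+1)%N -> is_cyl_of X (F n) (E n).
      rewrite ltnS leq_eqVlt /E => /orP[/eqP->|nk]; first by rewrite ltnn.
      by rewrite nk; exact: cD.
    have DE : \bigcap_(n in [set n | (n < k)%N]) D n =
        \bigcap_(n in [set n | (n < k)%N]) E n.
      by apply: eq_bigcapr => n nk; rewrite /E nk.
    have := iidF.2 k.+1 E cE; rewrite big_ord_recr/= -(iidF.2 k E) => [|n nk]; last first.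
      by apply: cE; rewrite ltnS ltnW.
    have EkC : E k = C by rewrite /E ltnn.
    have DCE : \bigcap_(n in [set n | (n < k.+1)%N]) E n =
        \bigcap_(n in [set n | (n < k)%N]) D n `&` C.
      rewrite DE; apply/seteqP; split=> [w h|w [h1 h2] n /=].
        split; first by move=> n /= nk; exact: (h n (leqW nk)).
        by rewrite -EkC; exact: (h k (ltnSn k)).
      by rewrite ltnS leq_eqVlt => /orP[/eqP->|nk]; [rewrite EkC|exact: h1].
    rewrite EkC -DE DCE; apply: fineP_mul => //.
    * apply: measurableI; last exact: measurable_cyl cC.
      by apply: (@past_measurable k); exists D.
    * by apply: (@past_measurable k); exists D.
    * exact: measurable_cyl cC.
- exact: preimage_sigma_cyl.
Qed.

(** The two laws agree on cylinders, a pi-system generating the events of [mapsp]. *)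
Lemma map_ident k (B : set mapsp) : measurable B ->
  P (F k @^-1` B) = P (F 0%N @^-1` B).
Proof.
pose f n : {mfun T >-> mapsp} :=
  HB.pack (F n : T -> mapsp) (isMeasurableFun.Build _ _ _ _ _ (measurable_map n)).
move=> mB; rewrite -[LHS]/(distribution P (f k) B) -[RHS]/(distribution P (f 0%N) B).
apply: (@measure_unique _ R mapsp (is_cyl_of X (fun phi : pt -> pt => phi))
  (fun=> setT) _ _ _ _ (distribution P (f k)) (distribution P (f 0%N))) => //.
- exact: cyl_setI.
- by move=> _; exact: cyl_setT.
- by rewrite bigcup_const.
- move=> A [m [xs [ix [Bs [HX HB ->]]]]].
  exact: iidF.1.
- move=> _; rewrite -[X in (X < _)%E]/(P (F k @^-1` setT)).
  by rewrite preimage_setT probability_setT ltry.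
Qed.

End IID.
End Cylinders.

(** * Euclidean norm and Borel sets *)

Section EuclideanNorm.
Variables (R : realType) (d : nat).
Local Notation pt := 'rV[R]_d.
Implicit Types u v : pt.

Lemma enorm_ge0 v : 0 <= enorm v. Proof. exact: sqrtr_ge0. Qed.

Lemma enorm_sqr v : enorm v ^+ 2 = dotp v v.
Proof.
rewrite sqr_sqrtr; first by apply: eq_bigr => i _; rewrite expr2.
by apply: sumr_ge0 => i _; rewrite sqr_ge0.
Qed.

Lemma enormN v : enorm (- v) = enorm v.
Proof. by congr Num.sqrt; apply: eq_bigr => i _; rewrite mxE sqrrN. Qed.

Lemma enorm_distC u v : enorm (u - v) = enorm (v - u).
Proof. by rewrite -enormN opprB. Qed.

Lemma enorm0 : enorm (0 : pt) = 0.
Proof. by rewrite /enorm big1 ?sqrtr0// => i _; rewrite mxE expr0n. Qed.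

Lemma enorm_eq0 v : (enorm v == 0) = (v == 0).
Proof.
apply/eqP/eqP => [v0|->]; last exact: enorm0.
by apply: dotp_eq0; rewrite -enorm_sqr v0 expr0n.
Qed.

Lemma enorm_gt0 v : (0 < enorm v) = (v != 0).
Proof. by rewrite lt0r enorm_ge0 andbT enorm_eq0. Qed.

Lemma le_coord_enorm v i : `|v ord0 i| <= enorm v.
Proof.
rewrite -(ler_pXn2r (n := 2)) ?nnegrE ?enorm_ge0// enorm_sqr real_normK ?num_real//.
rewrite /dotp (bigD1 i)//= -expr2 lerDl sumr_ge0// => j _.
by rewrite -expr2 sqr_ge0.
Qed.

(** The crude [d.+1] replaces $\sqrt d$; it can be divided by even when [d = 0]. *)
Lemma enorm_le_box v e : 0 < e -> (forall i, `|v ord0 i| < e) -> enorm v <= d.+1%:R * e.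
Proof.
move=> e0 ve; rewrite -(ler_pXn2r (n := 2)) ?nnegrE ?enorm_ge0 ?mulr_ge0 ?(ltW e0)//.
rewrite enorm_sqr (@le_trans _ _ (d%:R * e ^+ 2))//.
  rewrite mulr_natl -[X in _ *+ X]card_ord -sumr_const; apply: ler_sum => i _.
  by rewrite -expr2 -real_normK ?num_real// lerXn2r ?nnegrE ?(ltW e0)// ltW.
rewrite exprMn ler_wpM2r ?sqr_ge0// -natrX ler_nat.
by rewrite (leq_trans (leqnSn d))// -[X in (X <= _)%N]expn1 leq_pexp2l.
Qed.

(* Cauchy-Schwarz, from [0 <= |b u - a v|^2] with [a = |u|], [b = |v|]. *)
Lemma dotp_le_enorm u v : dotp u v <= enorm u * enorm v.
Proof.
have [/eqP|v0] := eqVneq (enorm v) 0.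
  rewrite enorm_eq0 => /eqP->; rewrite enorm0 mulr0 dotpC /dotp big1// => i _.
  by rewrite mxE mul0r.
have [/eqP|u0] := eqVneq (enorm u) 0.
  rewrite enorm_eq0 => /eqP->; rewrite enorm0 mul0r /dotp big1// => i _.
  by rewrite mxE mul0r.
have a0 : 0 < enorm u by rewrite lt0r u0 enorm_ge0.
have b0 : 0 < enorm v by rewrite lt0r v0 enorm_ge0.
have : 0 <= \sum_i (enorm v * u ord0 i - enorm u * v ord0 i) ^+ 2.
  by apply: sumr_ge0 => i _; rewrite sqr_ge0.
have -> : \sum_i (enorm v * u ord0 i - enorm u * v ord0 i) ^+ 2 =
    enorm v ^+ 2 * dotp u u + enorm u ^+ 2 * dotp v v
    - 2 * (enorm u * enorm v) * dotp u v.
  rewrite /dotp !mulr_sumr -big_split -sumrB; apply: eq_bigr => i _ /=; ring.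
rewrite -!enorm_sqr.
rewrite (_ : _ - _ = 2 * (enorm u * enorm v) * (enorm u * enorm v - dotp u v)); last by ring.
by rewrite pmulr_rge0 ?mulr_gt0// subr_ge0.
Qed.

Lemma ler_enormD u v : enorm (u + v) <= enorm u + enorm v.
Proof.
rewrite -(ler_pXn2r (n := 2)) ?nnegrE ?addr_ge0 ?enorm_ge0//.
rewrite enorm_sqr dotpDl (dotpC u) (dotpC v) !dotpDl -!enorm_sqr.
have := dotp_le_enorm u v; rewrite (dotpC v u); lra.
Qed.

Lemma ler_enorm_dist u v w : enorm (u - w) <= enorm (u - v) + enorm (v - w).
Proof. by rewrite (_ : u - w = (u - v) + (v - w)) ?ler_enormD// addrA subrK. Qed.

End EuclideanNorm.

(** * Separability of subsets of Euclidean space *)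

Section DenseSequence.
Variables (R : realType) (d : nat).
Local Notation pt := 'rV[R]_d.

(** One point of [X] is chosen in every box with rational centre and radius $1/(n+1)$ that meets
    [X]; the other indices get [x0], so that the sequence stays in [X]. *)
Lemma dense_seq (X : set pt) : X !=set0 ->
  exists2 dn : nat -> pt, forall j, X (dn j) &
    forall x e, X x -> 0 < e -> exists j, forall i, `|x ord0 i - dn j ord0 i| < e.
Proof.
move=> [x0 Xx0].
pose near (p : 'rV[rat]_d * nat) := [set y | X y /\
  forall i, `|y ord0 i - ratr (p.1 ord0 i)| < p.2.+1%:R^-1].
pose dn j := if unpickle j is Some p then xget x0 (near p) else x0.
have nearX p : X (xget x0 (near p)).
  by case: xgetP => [y -> []|].
exists dn => [j|x e Xx e0]; first by rewrite /dn; case: unpickle.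
have e2 : 0 < e / 2 by rewrite divr_gt0.
have [n ne] : exists n : nat, n.+1%:R^-1 < e / 2.
  exists (Num.truncn (e / 2)^-1); rewrite invf_plt ?posrE//.
  by rewrite Num.Theory.truncnS_gt.
have n0 : 0 < n.+1%:R^-1 :> R by rewrite invr_gt0.
have /choice[q qP] : forall i, exists q : rat, `|x ord0 i - ratr q| < n.+1%:R^-1.
  move=> i; have [|q] := @rat_in_itvoo R (x ord0 i - n.+1%:R^-1) (x ord0 i + n.+1%:R^-1).
    by rewrite ltrBlDr -addrA ltrDl addr_gt0.
  by rewrite in_itv/= => qx; exists q; rewrite ltr_distlC.
pose p := (\row_i q i, n).
have px : near p x by split=> // i; rewrite /p mxE.
exists (pickle p) => i; rewrite /dn pickleK.
have [_ /(_ i)] := xgetPex x0 (ex_intro _ x px).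
rewrite /= !mxE => h1; have := qP i => h2.
rewrite (le_lt_trans (ler_distD (ratr (q i)) _ _))// (splitr e).
by rewrite ltrD// ?(lt_trans h2 ne)// distrC (lt_trans h1 ne).
Qed.
End DenseSequence.

(** * The Borel structure on states *)

Section StateSpace.
Variables (R : realType) (d : nat).
Local Notation pt := 'rV[R]_d.

Definition statesp := g_sigma_algebraType (@open pt).
HB.instance Definition _ := Measurable.on statesp.

Lemma measurable_coord i :
  measurable_fun [set: statesp] (fun x : statesp => (x : pt) ord0 i).
Proof.
apply: (measurability _ (RGenOpens.measurableE R)) => _ [_ [a [b ->]] <-].
rewrite setTI; apply: sub_sigma_algebra.
apply: open_comp; last exact: interval_open.
by move=> x _; exact: coord_continuous.
Qed.

Context dT (T : measurableType dT).

Lemma measurable_enorm (f : T -> pt) :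
  (forall i, measurable_fun setT (fun w => f w ord0 i)) ->
  measurable_fun setT (fun w => enorm (f w)).
Proof.
move=> mf; apply: measurableT_comp; last first.
  by apply: measurable_sum => i; exact: measurable_funX.
exact: (continuous_measurable_fun (@sqrt_continuous R)).
Qed.

(** An open set is the union of the boxes it contains among the countably many with centre [dn j]
    and radius $1/(n+1)$, and a box is a condition on coordinates. *)
Lemma measurable_to_statesp (f : T -> statesp) :
  (forall i, measurable_fun setT (fun w => (f w : pt) ord0 i)) ->
  measurable_fun setT f.
Proof.
move=> mf; apply: (@measurability _ _ T statesp setT f (@open pt)) => // _ [B oB <-].
have [dn _ dnP] := @dense_seq R d setT (ex_intro _ 0 I).
pose box j n : set pt := [set y | forall i, `|y ord0 i - dn j ord0 i| < n.+1%:R^-1].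
rewrite setTI (_ : f @^-1` B =
    \bigcup_j \bigcup_(n in [set n | box j n `<=` B]) f @^-1` (box j n)).
  apply: bigcupT_measurable => j; apply: bigcup_measurable => n _.
  rewrite (_ : _ @^-1` _ = \bigcap_(i in [set: 'I_d])
      ((fun w => `|(f w : pt) ord0 i - dn j ord0 i|) @^-1` `]-oo, n.+1%:R^-1[)).
    apply: fin_bigcap_measurable => [|i _]; first exact: finite_finset.
    rewrite -[X in measurable X]setTI.
    have mfi : measurable_fun setT (fun w => `|(f w : pt) ord0 i - dn j ord0 i|).
      by apply: measurableT_comp => //; exact: measurable_funB.
    exact: mfi.
  apply/seteqP; split=> [w h i _|w h i]; first by rewrite /= in_itv/= h.
  by have := h i I; rewrite /= in_itv.
apply/seteqP; split=> [w Bw|w [j _ [n nB wn]]]; last exact: nB.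
have /nbhs_ballP[e /= e0 eB] : nbhs (f w : pt) B by exact: open_nbhs_nbhs.
have [n ne] : exists n : nat, n.+1%:R^-1 < e / 2.
  exists (Num.truncn (e / 2)^-1); rewrite invf_plt ?posrE ?divr_gt0//.
  by rewrite Num.Theory.truncnS_gt.
have [|j jP] := dnP (f w) n.+1%:R^-1 I; first by rewrite invr_gt0.
exists j => //; exists n; last exact: jP.
move=> y yP; apply: eB; split=> // k i; rewrite ord1.
rewrite /ball /= (le_lt_trans (ler_distD (dn j ord0 i) _ _))// (splitr e).
by rewrite ltrD// ?(lt_trans (jP i) ne)// distrC (lt_trans (yP i) ne).
Qed.

End StateSpace.

(** * Measurable versions of evaluation and of the local Lipschitz constant *)

Section MeasurableVersions.
Variables (R : realType) (d : nat) (X : set 'rV[R]_d) (dn : nat -> 'rV[R]_d).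
Local Notation pt := 'rV[R]_d.
Local Notation Z := (mapsp X).
Local Notation S := (statesp R d).
Hypothesis Xdn : forall j, X (dn j).

Definition near_dn (m : nat) (x : pt) (j : nat) : bool := enorm (dn j - x) < m.+1%:R^-1.

(* The upper limit at [x] along the dense sequence, written as a countable
   inf-sup; the default [-oo] is neutral for the supremum. *)
Definition lim_dn (psi : nat -> R) (x : pt) : \bar R :=
  einfs (fun m => esups (fun j => if near_dn m x j then (psi j)%:E else -oo%E) 0) 0.

(** A jointly measurable stand-in for $(x,\phi)\mapsto\phi(x)$, which reads $\phi$ on the dense
    sequence only. *)
Definition eval_dn (z : S * Z) : S :=
  \row_i fine (lim_dn (fun j => (z.2 : pt -> pt) (dn j) ord0 i) z.1).

(** [Dlip] with pairs from the dense sequence and radii $1/(m+1)$. The default 0 corresponds to the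
    point 0 added to the set in [Dlip]. *)
Definition Dlip_dn (z : S * Z) : \bar R :=
  einfs (fun m => esups (fun j => esups (fun l =>
    if [&& near_dn m z.1 j, near_dn m z.1 l & dn j != dn l]
    then (enorm ((z.2 : pt -> pt) (dn j) - (z.2 : pt -> pt) (dn l)) /
          enorm (dn j - dn l))%:E
    else 0%E) 0) 0) 0.

Lemma measurable_eval_at j i :
  measurable_fun [set: Z] (fun phi : Z => (phi : pt -> pt) (dn j) ord0 i).
Proof.
move=> _ B mB; rewrite setTI; apply: sub_sigma_algebra.
exists 1%N, (fun=> dn j), (fun=> i), (fun=> B); split=> //.
by apply/seteqP; split=> [phi h _|phi h]; [exact: h|exact: (h ord0)].
Qed.

Lemma measurable_near_dn m j : measurable_fun [set: S] (fun x : S => near_dn m x j).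
Proof.
apply: measurable_fun_ltr; last exact: measurable_cst.
apply: measurable_enorm => i.
rewrite (_ : (fun _ => _) = fun w : S => dn j ord0 i - (w : pt) ord0 i).
  by apply: measurable_funB; [exact: measurable_cst|exact: measurable_coord].
by apply/funext => w; rewrite !mxE.
Qed.

Lemma measurable_eval_dn : measurable_fun setT eval_dn.
Proof.
apply: measurable_to_statesp => i.
rewrite (_ : (fun _ => _) = fun z : S * Z =>
    fine (lim_dn (fun j => (z.2 : pt -> pt) (dn j) ord0 i) z.1)).
  apply: measurableT_comp => //.
  apply: measurable_fun_einfs => m; apply: measurable_fun_esups => j.
  apply: measurable_fun_ifT.
  - exact: (measurableT_comp (measurable_near_dn m j) measurable_fst).
  - apply/measurable_EFinP.
    exact: (measurableT_comp (measurable_eval_at j i) measurable_snd).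
  - exact: measurable_cst.
by apply/funext => z; rewrite mxE.
Qed.

Lemma measurable_Dlip_dn : measurable_fun setT Dlip_dn.
Proof.
apply: measurable_fun_einfs => m; apply: measurable_fun_esups => j.
apply: measurable_fun_esups => l.
apply: measurable_fun_ifT; last exact: measurable_cst.
- apply: measurable_and.
    exact: (measurableT_comp (measurable_near_dn m j) measurable_fst).
  apply: measurable_and; last exact: measurable_cst.
  exact: (measurableT_comp (measurable_near_dn m l) measurable_fst).
- apply/measurable_EFinP; apply: measurable_funM; last exact: measurable_cst.
  apply: measurable_enorm => i.
  rewrite (_ : (fun _ => _) = fun z : S * Z =>
      (z.2 : pt -> pt) (dn j) ord0 i - (z.2 : pt -> pt) (dn l) ord0 i).
    apply: measurable_funB.
      exact: (measurableT_comp (measurable_eval_at j i) measurable_snd).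
    exact: (measurableT_comp (measurable_eval_at l i) measurable_snd).
  by apply/funext => z; rewrite !mxE.
Qed.

(** The diagonal pair [j = l = 0] contributes the default 0 at every radius. *)
Lemma Dlip_dn_ge0 z : (0 <= Dlip_dn z)%E.
Proof.
apply: le_ereal_inf_tmp => _ [m _ <-].
rewrite (@le_trans _ _ (esups (fun l =>
    if [&& near_dn m z.1 0%N, near_dn m z.1 l & dn 0%N != dn l]
    then (enorm ((z.2 : pt -> pt) (dn 0%N) - (z.2 : pt -> pt) (dn l)) /
          enorm (dn 0%N - dn l))%:E
    else 0%E) 0))//; last by apply: ereal_sup_ubound; exists 0%N.
by apply: ereal_sup_ubound; exists 0%N => //=; rewrite eqxx !andbF.
Qed.

Hypothesis dense_dn : forall x e, X x -> 0 < e -> exists j, enorm (dn j - x) < e.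

Let inv_lt (e : R) : 0 < e -> exists n : nat, n.+1%:R^-1 < e.
Proof.
move=> e0; exists (Num.truncn e^-1); rewrite invf_plt ?posrE//.
by rewrite Num.Theory.truncnS_gt.
Qed.

(** Continuity squeezes the values taken near [x]; density provides an index near [x] at every
    scale, so that no supremum is [-oo]. *)
Lemma lim_dnE (psi : pt -> R) x : X x ->
  (forall e, 0 < e -> exists2 delta, 0 < delta &
     forall y, X y -> enorm (y - x) < delta -> `|psi y - psi x| < e) ->
  lim_dn (psi \o dn) x = (psi x)%:E.
Proof.
move=> Xx cpsi; apply/eqP; rewrite eq_le; apply/andP; split.
  apply/lee_addgt0Pr => e e0; have [delta delta0 hd] := cpsi e e0.
  have [m md] := inv_lt delta0.
  apply: (@le_trans _ _
    (esups (fun j => if near_dn m x j then (psi (dn j))%:E else -oo%E) 0)).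
    by apply: ereal_inf_lbound; exists m.
  apply: ge_ereal_sup => _ [j _ <-]; case: ifPn => [nj|_]; last exact: leNye.
  rewrite -EFinD lee_fin; have := hd _ (Xdn j) (lt_trans nj md).
  by rewrite ltr_distlC => /andP[/ltW + _]; rewrite lerBlDr.
apply: le_ereal_inf_tmp => _ [m _ <-]; apply/lee_addgt0Pr => e e0.
have [delta delta0 hd] := cpsi e e0.
have m0 : 0 < m.+1%:R^-1 :> R by rewrite invr_gt0.
have [|j] := dense_dn (e := Num.min delta m.+1%:R^-1) Xx; first by rewrite lt_min delta0.
rewrite lt_min => /andP[jd jm].
apply: (@le_trans _ _ ((psi (dn j))%:E + e%:E)%E).
  by rewrite -EFinD lee_fin; have := hd _ (Xdn j) jd; rewrite ltr_distlC => /andP[]; lra.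
by rewrite leeD2r//; apply: ereal_sup_ubound; exists j => //=; rewrite /near_dn jm.
Qed.

Variable phi : pt -> pt.
Hypothesis lphi : locally_lipschitz_on X phi.

Let lip_at x : X x -> exists delta L : R, [/\ 0 < delta, 0 <= L &
    forall y z, X y -> X z -> enorm (y - x) < delta -> enorm (z - x) < delta ->
      enorm (phi y - phi z) <= L * enorm (y - z)].
Proof.
move=> /lphi[delta [L [delta0 H]]]; exists delta, `|L|; split=> // y z Xy Xz yx zx.
by apply: (le_trans (H _ _ Xy Xz yx zx)); rewrite ler_wpM2r ?enorm_ge0// ler_norm.
Qed.

Lemma lip_cont x e : X x -> 0 < e -> exists2 delta, 0 < delta &
  forall y, X y -> enorm (y - x) < delta -> enorm (phi y - phi x) < e.
Proof.
move=> Xx e0; have [delta [L [delta0 L0 H]]] := lip_at Xx.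
have L1 : 0 < L + 1 by rewrite ltr_wpDl.
exists (Num.min delta (e / (L + 1))) => [|y Xy]; first by rewrite lt_min delta0 divr_gt0.
rewrite lt_min => /andP[yd ye].
apply: (le_lt_trans (H y x Xy Xx yd _)); first by rewrite subrr enorm0.
move: ye; rewrite ltr_pdivlMr// mulrC; apply: le_lt_trans.
by rewrite ler_wpM2r ?enorm_ge0// lerDl.
Qed.

Lemma eval_dnE x : X x -> eval_dn (x, phi) = phi x.
Proof.
move=> Xx; apply/rowP => i; rewrite mxE /=.
rewrite (@lim_dnE (fun y => phi y ord0 i))// => e /(lip_cont Xx)[delta delta0 H].
exists delta => // y Xy /(H _ Xy); apply: le_lt_trans.
by have := le_coord_enorm (phi y - phi x) i; rewrite !mxE.
Qed.

(** A bound on difference quotients over dense points of a ball extends to all points of [X] in it,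
    by approximating both endpoints. *)
Let quot_le_sup (x y z : pt) (r s : R) : 0 <= s -> X y -> X z -> y != z ->
  enorm (y - x) < r -> enorm (z - x) < r ->
  (forall j l, enorm (dn j - x) < r -> enorm (dn l - x) < r -> dn j != dn l ->
    enorm (phi (dn j) - phi (dn l)) / enorm (dn j - dn l) <= s) ->
  enorm (phi y - phi z) / enorm (y - z) <= s.
Proof.
move=> s0 Xy Xz yz yr zr H.
have H' j l : enorm (dn j - x) < r -> enorm (dn l - x) < r ->
    enorm (phi (dn j) - phi (dn l)) <= s * enorm (dn j - dn l).
  move=> jr lr; have [->|jl] := eqVneq (dn j) (dn l).
    by rewrite !subrr enorm0 mulr0.
  by rewrite -ler_pdivrMr ?H// enorm_gt0 subr_eq0.
rewrite ler_pdivrMr ?enorm_gt0 ?subr_eq0//.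
apply/ler_addgt0Pr => e e0.
(* Moving the endpoints costs [2 * e'] in the images and [2 * s * e'] in the arguments, [e] in
   total. *)
pose e' := e / (2 * (s + 1)).
have e'0 : 0 < e' by rewrite divr_gt0// mulr_gt0// ltr_wpDl.
have [dy dy0 hy] := lip_cont Xy e'0; have [dz dz0 hz] := lip_cont Xz e'0.
(* The bound [r - enorm (y - x)] keeps the approximating point in the ball of radius [r]. *)
have [|j] := dense_dn (e := Num.min (Num.min dy e') (r - enorm (y - x))) Xy.
  by rewrite !lt_min dy0 e'0 subr_gt0.
rewrite !lt_min => /andP[/andP[jdy jye] jr].
have [|l] := dense_dn (e := Num.min (Num.min dz e') (r - enorm (z - x))) Xz.
  by rewrite !lt_min dz0 e'0 subr_gt0.
rewrite !lt_min => /andP[/andP[ldz lze] lr].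
have := H' j l; have := hy _ (Xdn j) jdy; have := hz _ (Xdn l) ldz.
have := ler_enorm_dist (dn j) y x; have := ler_enorm_dist (dn l) z x.
have t1 := ler_enorm_dist (phi y) (phi (dn j)) (phi z).
have t2 := ler_enorm_dist (phi (dn j)) (phi (dn l)) (phi z).
have t3 := ler_enorm_dist (dn j) y (dn l).
have t4 := ler_enorm_dist y z (dn l).
rewrite (enorm_distC (phi y) (phi (dn j))) in t1; rewrite (enorm_distC z (dn l)) in t4.
move=> q1 q2 q3 q4 q5.
have {}q5 := q5 (le_lt_trans q2 _) (le_lt_trans q1 _).
have {}q5 : enorm (phi (dn j) - phi (dn l)) <= s * enorm (dn j - dn l) by apply: q5; lra.
have q6 : s * enorm (dn j - dn l) <= s * (enorm (y - z) + 2 * e').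
  by rewrite ler_wpM2l//; lra.
have ee : e = 2 * (s + 1) * e'.
  by rewrite /e' mulrC divfK// mulf_neq0// gt_eqF// ltr_wpDl.
rewrite ee; lra.
Qed.

(** Pairs of dense points are among all pairs and the radii $1/(m+1)$ tend to 0; conversely
    [quot_le_sup] bounds all quotients at each such radius. *)
Lemma Dlip_dnE x : X x -> Dlip_dn (x, phi) = Dlip X phi x.
Proof.
move=> Xx; apply/eqP; rewrite eq_le; apply/andP; split.
  apply: le_ereal_inf_tmp => _ [delta /= delta0 <-].
  have [m md] := inv_lt delta0.
  apply: (@le_trans _ _ (esups (fun j => esups (fun l =>
    if [&& near_dn m x j, near_dn m x l & dn j != dn l]
    then (enorm (phi (dn j) - phi (dn l)) / enorm (dn j - dn l))%:E
    else 0%E) 0) 0)); first by apply: ereal_inf_lbound; exists m.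
  apply: ge_ereal_sup => _ [j _ <-]; apply: ge_ereal_sup => _ [l _ <-].
  apply: ereal_sup_ubound; case: ifPn => [/and3P[nj nl jl]|_]; last by left.
  right; exists (dn j), (dn l); split=> //.
  - by rewrite (lt_trans _ md).
  - by rewrite (lt_trans _ md).
apply: le_ereal_inf_tmp => _ [m _ <-].
set s := esups _ _.
have m0 : 0 < m.+1%:R^-1 :> R by rewrite invr_gt0.
have inner j l : ((if [&& near_dn m x j, near_dn m x l & dn j != dn l]
    then (enorm (phi (dn j) - phi (dn l)) / enorm (dn j - dn l))%:E
    else 0%E) <= s)%E.
  apply: (@le_trans _ _ (esups (fun l =>
    if [&& near_dn m x j, near_dn m x l & dn j != dn l]
    then (enorm (phi (dn j) - phi (dn l)) / enorm (dn j - dn l))%:E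
    else 0%E) 0)); first by apply: ereal_sup_ubound; exists l.
  by apply: ereal_sup_ubound; exists j.
have s0 : (0 <= s)%E by have := inner 0%N 0%N; rewrite eqxx !andbF.
apply: (@le_trans _ _ (ereal_sup ([set 0%E] `|`
      [set e | exists y z, [/\ X y /\ X z,
                   enorm (y - x) < m.+1%:R^-1, enorm (z - x) < m.+1%:R^-1,
                   y != z & e = (enorm (phi y - phi z) / enorm (y - z))%:E]]))).
  by apply: ereal_inf_lbound; exists m.+1%:R^-1.
apply: ge_ereal_sup => _ [->//|[y [z [[Xy Xz] yr zr yz ->]]]].
case: s s0 inner => [s s0 inner|_ _|//]; last exact: leey.
rewrite lee_fin; apply: quot_le_sup yr zr _ => // j l jr lr jl.
by have := inner j l; rewrite /near_dn jr lr jl lee_fin.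
Qed.

Lemma Dlip_fin_num x : X x -> Dlip X phi x \is a fin_num.
Proof.
move=> Xx; rewrite ge0_fin_numE -?Dlip_dnE ?Dlip_dn_ge0//.
rewrite Dlip_dnE//; have [delta [L [delta0 L0 H]]] := lip_at Xx.
apply: (@le_lt_trans _ _ L%:E); last exact: ltry.
apply: (@le_trans _ _ (ereal_sup ([set 0%E] `|`
      [set e | exists y z, [/\ X y /\ X z, enorm (y - x) < delta, enorm (z - x) < delta,
                   y != z & e = (enorm (phi y - phi z) / enorm (y - z))%:E]]))).
  by apply: ereal_inf_lbound; exists delta.
apply: ge_ereal_sup => _ [->|[y [z [[Xy Xz] yr zr yz ->]]]]; rewrite lee_fin//.
by rewrite ler_pdivrMr ?enorm_gt0 ?subr_eq0// H.
Qed.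

End MeasurableVersions.

(** * The Poisson equation *)

Section NullCongruence.
Local Open Scope ereal_scope.
Context d (T : measurableType d) (R : realType).
Variables (mu : {measure set T -> \bar R}) (N : set T).
Hypotheses (mN : measurable N) (muN : mu N = 0).
Import HBNNSimple.

Let sintegral_sup_le (f g : T -> \bar R) : (forall x, 0 <= g x) ->
  (forall x, ~ N x -> f x = g x) ->
  ereal_sup [set sintegral mu h |
    h in [set h : {nnsfun T >-> R} | forall x, (h x)%:E <= f x]] <=
  ereal_sup [set sintegral mu h |
    h in [set h : {nnsfun T >-> R} | forall x, (h x)%:E <= g x]].
Proof.
move=> g0 fg; apply: ge_ereal_sup => _ [h hf <-].
apply: ereal_sup_ubound; exists (proj_nnsfun h (measurableC mN)) => [x|].
  rewrite /= mindicE; have [|_] := boolP (x \in _); last by rewrite mulr0.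
  by rewrite inE => Nx; rewrite mulr1 -fg.
rewrite -!integralT_nnsfun; apply: ge0_ae_eq_integral => //.
- by apply/measurable_EFinP; exact: measurable_funP.
- by apply/measurable_EFinP; exact: measurable_funP.
- by move=> x _; rewrite lee_fin.
- by move=> x _; rewrite lee_fin.
- exists N; split => // x /= h1; apply: contrapT => Nx; apply: h1 => _.
  by rewrite /= mindicE mem_set// mulr1.
Qed.

(* No measurability is required: the integral of a nonnegative function is a
   supremum over simple minorants, which may be cut off on the null set. *)
Lemma integral_null_congr (f g : T -> \bar R) : (forall x, ~ N x -> f x = g x) ->
  \int[mu]_x f x = \int[mu]_x g x.
Proof.
move=> fg; rewrite /integral; congr (_ - _);
  apply/eqP; rewrite eq_le; apply/andP; split; apply: sintegral_sup_le => // x Nx;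
  by rewrite ?funeposE ?funenegE !patchT ?in_setT// fg.
Qed.

End NullCongruence.

(** * The chain of random maps as a weighted chain, and the residual bound *)

Section Potential.
Variables (R : realType) (d : nat) (X : set 'rV[R]_d)
  (dT : measure_display) (T : measurableType dT) (P : probability T R)
  (F : nat -> T -> 'rV[R]_d -> 'rV[R]_d) (U : 'rV[R]_d -> R).
Local Notation pt := 'rV[R]_d.
Local Notation S := (statesp R d).
Local Notation Z := (mapsp X).
Hypotheses (cX : compact X)
  (FX : forall n w x, X x -> X (F n w x))
  (mF : forall n x (i : 'I_d), X x -> measurable_fun setT (fun w => F n w x ord0 i))
  (iidF : iid_maps X P F)
  (bU : borel_on X U)
  (U0 : forall x, X x -> 0 <= U x).
Variable dn : nat -> pt.
Hypotheses (Xdn : forall j, X (dn j))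
  (dense_dn : forall x e, X x -> 0 < e -> exists j, enorm (dn j - x) < e).
Variable N : set T.
Hypotheses (mN : measurable N) (PN : P N = 0%E)
  (lipF : forall w, ~ N w -> forall n, locally_lipschitz_on X (F n w)).

Let xi : nat -> T -> Z := F.
Let st : S * Z -> S := eval_dn dn.
Let wt : S * Z -> \bar R := Dlip_dn dn.

(** [U] is controlled on [X] only; extension by 0 makes it measurable and nonnegative on all
    states. *)
Definition Uext : S -> \bar R := (EFin \o U) \_ X.

Lemma measurable_state_set : measurable (X : set S).
Proof.
rewrite -[X]setCK; apply: measurableC; apply: sub_sigma_algebra.
by rewrite /= openC; apply: compact_closed => //; exact: norm_hausdorff.
Qed.

Lemma measurable_Uext : measurable_fun setT Uext.
Proof.
apply/(measurable_restrictT _ measurable_state_set).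
by apply/measurable_EFinP => _ B mB; exact: bU.
Qed.

Lemma Uext_ge0 s : (0 <= Uext s)%E.
Proof. by rewrite /Uext patchE; case: ifPn => // /set_mem/U0. Qed.

Lemma UextE x : X x -> Uext x = (U x)%:E.
Proof. by move=> Xx; rewrite /Uext patchE mem_set. Qed.

Lemma chain_in x k w : X x -> X (chain F x k w).
Proof. by move=> Xx; elim: k => //= k; exact: FX. Qed.

Lemma wstateE x k w : ~ N w -> X x -> wstate xi st x k w = chain F x k w.
Proof.
move=> Nw Xx; elim: k => //= k ->; rewrite /st eval_dnE//; first exact: lipF.
exact: chain_in.
Qed.

Lemma wweightE x k w : ~ N w -> X x -> wweight xi st wt x k w =
  (\prod_(l < k) Dlip X (F l w) (chain F x l w))%E.
Proof.
move=> Nw Xx; elim: k => [|k IH]; first by rewrite big_ord0.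
rewrite big_ord_recr /= IH wstateE// /wt Dlip_dnE//; first exact: lipF.
exact: chain_in.
Qed.

Let mst : measurable_fun [set: S * Z] st := measurable_eval_dn Xdn.
Let mwt : measurable_fun [set: S * Z] wt := measurable_Dlip_dn Xdn.
Let wt0 z : (0 <= wt z)%E := Dlip_dn_ge0 dn z.

Let V := wpotential P xi st wt Uext.

Lemma measurable_V : measurable_fun setT V.
Proof.
apply: (@measurable_wpotential _ _ _ S Z T R P xi st wt) => //.
- exact: measurable_map.
- exact: measurable_Uext.
- exact: Uext_ge0.
Qed.

Lemma V_ge0 s : (0 <= V s)%E.
Proof.
apply: nneseries_ge0 => k _ _.
have [] // := @wker_iter _ _ _ S Z T R P xi st wt _ mst mwt wt0 Uext k.
- exact: measurable_map.
- exact: measurable_Uext.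
- exact: Uext_ge0.
Qed.

Lemma V_poisson x : V x = (Uext x + wker P xi st wt V x)%E.
Proof.
apply: (@wpotential_poisson _ _ _ S Z T R P xi st wt) => //.
- exact: measurable_map.
- exact: measurable_Uext.
- exact: Uext_ge0.
Qed.

(** The potential is the integral of the series along the measurable chain, which off [N] is the
    chain of the theorem. *)
Lemma VstarE x : X x -> Vstar X P F U x = V x.
Proof.
move=> Xx; rewrite /V (@wpotentialE _ _ _ S Z T R P xi (past X F) st wt)//; last first.
- exact: Uext_ge0.
- exact: measurable_Uext.
- by move=> k B mB; exact: map_ident.
- by move=> k A B sA mB; exact: past_indep.
- by move=> k B mB; exact: past_preimage.
- by move=> k; exact: past_sub.
- by move=> k; exact: past_measurable.
- by move=> k; exact: measurable_map.
apply: (integral_null_congr mN PN) => w Nw.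
apply: eq_eseriesr => k _; rewrite wweightE// wstateE// UextE; last exact: chain_in.
by rewrite muleC.
Qed.

Lemma wker_Dlip (h : S -> \bar R) x : X x ->
  wker P xi st wt h x = (\int[P]_w (Dlip X (F 0%N w) x * h (F 0%N w x)))%E.
Proof.
move=> Xx; apply: (integral_null_congr mN PN) => w Nw.
by rewrite /wt /st Dlip_dnE ?eval_dnE//; exact: lipF.
Qed.


(** By the Poisson equation for [V] the residual equals $K(\theta-V)+(V-\theta)$, whose terms are at
    most $\eta M$ and $\eta$. *)
Lemma Kop_estimate (M eta : R) (theta : pt -> R) (x : pt) :
  measurable_fun [set: S] theta -> 0 <= eta ->
  (forall y, X y -> (V y < +oo)%E) ->
  (forall y, X y -> `|fine (V y) - theta y| <= eta) ->
  X x -> (\int[P]_w Dlip X (F 0%N w) x <= M%:E)%E ->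
  `|Kop X P F theta x - theta x + U x| <= eta * (M + 1).
Proof.
move=> mtheta eta0 Vfin thetaV Xx DM.
have Vfn y : X y -> V y \is a fin_num by move=> Xy; rewrite ge0_fin_numE ?V_ge0// Vfin.
pose Y w : S := st (x, xi 0%N w).
(* On [N] the point [Y w] may leave [X], where [theta] and [V] are not close; cutting [D] there
   makes the bound on [f - g] hold everywhere. *)
pose D w : R := fine (wt (x, xi 0%N w)) * \1_(~` N) w.
pose f w : R := D w * theta (Y w).
pose g w : R := D w * fine (V (Y w)).
have mx : measurable_fun setT (fun w => (x : S, xi 0%N w)).
  by apply: measurable_fun_pair => //; exact: measurable_map.
have mY : measurable_fun setT Y by exact: (measurableT_comp mst mx).
have mD : measurable_fun setT D.
  apply: measurable_funM; last exact/measurable_indic/measurableC.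
  apply: (measurableT_comp (f := fine)); last exact: (measurableT_comp mwt mx).
  exact: fine_measurable.
have mf : measurable_fun setT f.
  by apply: measurable_funM => //; exact: (measurableT_comp mtheta mY).
have mg : measurable_fun setT g.
  apply: measurable_funM => //; apply: measurableT_comp => //.
  exact: (measurableT_comp measurable_V mY).
have D0 w : 0 <= D w by rewrite mulr_ge0 ?fine_ge0// indicE.
have g0 w : 0 <= g w by rewrite mulr_ge0 ?fine_ge0// V_ge0.
have DE w : ~ N w -> (D w)%:E = Dlip X (F 0%N w) x.
  move=> Nw; rewrite /D indicE mem_set// mulr1 /wt Dlip_dnE//; last exact: lipF.
  by rewrite fineK// (Dlip_fin_num Xdn dense_dn)//; exact: lipF.
have YE w : ~ N w -> Y w = F 0%N w x by move=> Nw; rewrite /Y /st eval_dnE//; exact: lipF.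
have DN w : N w -> D w = 0 by move=> Nw; rewrite /D indicE memNset ?mulr0//; exact.
have intD : (\int[P]_w (D w)%:E <= M%:E)%E.
  by rewrite (integral_null_congr mN PN (g := fun w => Dlip X (F 0%N w) x)).
have intg : (\int[P]_w (g w)%:E)%E = wker P xi st wt V x.
  rewrite wker_Dlip//; apply: (integral_null_congr mN PN) => w Nw.
  by rewrite EFinM DE// YE// fineK// Vfn//; exact: FX.
have VE : V x = ((U x)%:E + \int[P]_w (g w)%:E)%E by rewrite intg V_poisson UextE.
have iD : P.-integrable setT (EFin \o D).
  apply/integrableP; split; first exact/measurable_EFinP.
  under eq_integral => w _ do rewrite /= ger0_norm//.
  by apply: le_lt_trans intD _; exact: ltry.
have ig : P.-integrable setT (EFin \o g).
  apply/integrableP; split; first exact/measurable_EFinP.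
  under eq_integral => w _ do rewrite /= ger0_norm//.
  (* The integral of [g] is a summand of the finite [V x]. *)
  by have := Vfin x Xx; rewrite VE; apply: le_lt_trans; rewrite leeDr// lee_fin U0.
have iDe : P.-integrable setT (EFin \o (fun w => eta * D w)).
  by have := integrableZl measurableT eta iD.
have fg w : `|f w - g w| <= eta * D w.
  rewrite /f /g -mulrBr normrM ger0_norm// mulrC.
  have [Nw|Nw] := pselect (N w); first by rewrite DN// !mulr0.
  by rewrite ler_wpM2r// YE// distrC thetaV//; exact: FX.
have ifg : P.-integrable setT (EFin \o (fun w => f w - g w)).
  apply: le_integrable iDe => //.
    by apply/measurable_EFinP; exact: measurable_funB.
  by move=> w _ /=; rewrite lee_fin (le_trans (fg w))// ler_norm.
(* [f] is the sum of [f - g], dominated by [eta * D], and of the integrable [g]. *)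
have i_f : P.-integrable setT (EFin \o f).
  have := integrableD measurableT ifg ig; apply: eq_integrable => // w _ /=.
  by rewrite -EFinD subrK.
have KE : Kop X P F theta x = \int[P]_w f w.
  rewrite /Kop; congr fine; apply: (integral_null_congr mN PN) => w Nw.
  by rewrite EFinM DE// YE.
have VE' : fine (V x) = U x + \int[P]_w g w.
  by rewrite VE fineD//; exact: integrable_fin_num ig.
rewrite KE (_ : _ - _ + _ = \int[P]_w (f w - g w) + (fine (V x) - theta x)); last first.
  by rewrite RintegralB// VE'; ring.
rewrite (le_trans (ler_normD _ _))// mulrDr mulr1 lerD ?thetaV//.
apply: (le_trans (le_normr_Rintegral _ _)) => //.
apply: (@le_trans _ _ (\int[P]_w (eta * D w))).
  by apply: le_Rintegral => //; have := integrable_norm ifg.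
rewrite RintegralZl// ler_wpM2l//.
by rewrite -lee_fin /Rintegral fineK//; exact: integrable_fin_num.
Qed.

End Potential.

(** * Measurability of networks and conclusion *)

Lemma sigmoid_continuous (R : realType) : continuous (@sigmoid R).
Proof.
move=> t; apply: cvgV; first by rewrite gt_eqF// addr_gt0// expR_gt0.
apply: cvgD; first exact: cvg_cst.
by apply: continuous_comp; [exact: opp_continuous|exact: continuous_expR].
Qed.

Lemma measurable_nnet (R : realType) (d N : nat) (a : 'I_N -> R) W b c :
  measurable_fun [set: statesp R d] (nnet a W b c : 'rV[R]_d -> R).
Proof.
apply: measurable_funD => //; apply: measurable_sum => j.
apply: measurable_funM => //; apply: measurableT_comp.
  exact: continuous_measurable_fun (@sigmoid_continuous R).
apply: measurable_funD => //; apply: measurable_sum => i.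
by apply: measurable_funM => //; exact: measurable_coord.
Qed.

Theorem theorem2 (R : realType) (d : nat) (X : set 'rV[R]_d)
  (dT : measure_display) (T : measurableType dT) (P : probability T R)
  (F : nat -> T -> 'rV[R]_d -> 'rV[R]_d) (U : 'rV[R]_d -> R) :
  compact X ->
  (forall n w x, X x -> X (F n w x)) ->
  (forall n x (i : 'I_d), X x -> measurable_fun setT (fun w => F n w x ord0 i)) ->
  iid_maps X P F ->
  (forall n, {ae P, forall w, locally_lipschitz_on X (F n w)}) ->
  borel_on X U ->
  (exists c : R, 0 < c /\ forall x, X x -> c <= U x) ->
  (exists M : R, forall x, X x -> (\int[P]_w Dlip X (F 0%N w) x <= M%:E)%E) ->
  (forall x, X x -> (Vstar X P F U x < +oo)%E) ->
  {within X, continuous (fun x => fine (Vstar X P F U x))} ->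
  forall eps : R, 0 < eps ->
  exists (N : nat) (a : 'I_N -> R) (W : 'I_N -> 'rV[R]_d) (b : 'I_N -> R) (c : R),
    (supnorm X (fun x => (Kop X P F (nnet a W b c) x - nnet a W b c x + U x)%R) < eps%:E)%E.
Proof.
move=> cX FX mF iidF lipF bU [u [u0 uU]] [M DM] Vfin cV eps eps0.
(* A dense sequence requires a point of [X]; over the empty set the supremum is [-oo]. *)
have [[x0 Xx0]|X0] := pselect (X !=set0); last first.
  exists 0%N, (fun=> 0), (fun=> 0), (fun=> 0), 0.
  rewrite /supnorm (_ : [set _ | _ in X] = set0) ?ereal_sup0 ?ltNyr//.
  by rewrite -subset0 => t [x Xx _]; apply: X0; exists x.
have U0 x : X x -> 0 <= U x by move=> /uU; apply: le_trans; exact: ltW.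
have [dn Xdn dnP] := dense_seq (ex_intro _ x0 Xx0).
have dense_dn x e : X x -> 0 < e -> exists j, enorm (dn j - x) < e.
  move=> Xx e0; have e1 : 0 < e / 2 / d.+1%:R by rewrite !divr_gt0.
  have [j jP] := dnP x _ Xx e1; exists j; rewrite enorm_distC.
  apply: (@le_lt_trans _ _ (e / 2)); last by rewrite ltr_pdivrMr// mulr_natr mulr2n ltrDl.
  rewrite -[leRHS](divfK (_ : d.+1%:R != 0))// mulrC.
  by apply: enorm_le_box => // i; rewrite !mxE.
(* A single null set serves all the maps [F n]. *)
have [N [mN PN lipN]] := ae_foralln lipF.
have {}lipN w : ~ N w -> forall n, locally_lipschitz_on X (F n w).
  by move=> Nw; apply: contrapT => h; apply: Nw; apply: lipN => /= h'; exact: h.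
have VE := VstarE cX FX mF iidF bU U0 Xdn dense_dn mN PN lipN.
set V := wpotential _ _ _ _ _ in VE.
have M1 : 0 < `|M| + 1 by rewrite ltr_wpDl.
(* The residual is then at most [eps / 2], so the supremum stays strictly below [eps]; [M] may be
   negative, whence the absolute value. *)
pose eta := eps / 2 / (`|M| + 1).
have eta0 : 0 < eta by rewrite !divr_gt0.
have [n [a [W [b nV]]]] := nnet_dense cX cV eta0.
exists n, a, W, b, 0.
apply: (@le_lt_trans _ _ (eps / 2)%:E); last first.
  by rewrite lte_fin ltr_pdivrMr// mulr_natr mulr2n ltrDl.
apply: ge_ereal_sup => _ [x Xx <-]; rewrite lee_fin.
rewrite (_ : eps / 2 = eta * (`|M| + 1)); last by rewrite divfK// gt_eqF.
apply: (Kop_estimate cX FX mF bU U0 Xdn dense_dn mN PN lipN) => //.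
- exact: measurable_nnet.
- exact: ltW.
- by move=> y Xy; rewrite -/V -VE// Vfin.
- by move=> y Xy; rewrite -/V -VE// nV.
- by apply: (le_trans (DM x Xx)); rewrite lee_fin ler_norm.
Qed.
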